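(* Let $W$ be a real random variable. Assume that there exist a deterministic constant $\delta>0$, a random positive measure $\hat\mu$ with support in $[-\delta,\delta]$, and a random variable $R$ such that $$E\bigl(Wf(W)\bigr)=E\int_{|t|\le\delta} f'(W+t)\,d\hat\mu(t)+E\bigl(Rf(W)\bigr)$$ for all absolutely continuous functions $f$ for which the expectation of either side exists. Let $D=\int_{|t|\le\delta}d\hat\mu(t)$. Suppose that there exist constants $\delta_1,\delta_2$ and $\theta\ge 1$ such that (almost surely) (i) $|E(D|W)-1|\le\delta_1(1+|W|)$; (ii) either $|E(R|W)|\le\delta_2(1+|W|)$ (first alternative), or $|E(R|W)|\le\delta_2(1+W^2)$ and $\delta_2|W|\le\alpha$ for some constant $\alpha<1$ (second alternative); (iii) $E(D|W)\le\theta$. Then $$\frac{P(W>x)}{1-\Phi(x)}=1+O_\alpha(1)\,\theta^3(1+x^3)(\delta+\delta_1+\delta_2)$$ for $0\le x\le\theta^{-1}\min(\delta^{-1/3},\delta_1^{-1/3},\delta_2^{-1/3})$, where $O_\alpha(1)$ denotes a quantity whose absolute value is bounded by a universal constant which depends on $\alpha$ only under the second alternative of (ii).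
   Context: $\Phi$ is the standard normal distribution function. If $\delta_1=0$ or $\delta_2=0$, the corresponding $\delta_i^{-1/3}$ is read as $+\infty$. The universal constant bounding $O_\alpha(1)$ does not depend on $W$, $x$, $\delta$, $\delta_1$, $\delta_2$, $\theta$ (and is absolute under the first alternative). *)

(* Defs.v *)
From HB Require Import structures.
From mathcomp Require Import all_boot all_order all_algebra.
From mathcomp Require Import all_classical all_reals all_analysis.

Set Implicit Arguments.
Unset Strict Implicit.
Unset Printing Implicit Defensive.

Import Order.TTheory GRing.Theory Num.Theory.
Import numFieldNormedType.Exports.

Local Open Scope classical_set_scope.
Local Open Scope ring_scope.

Definition absolutely_continuous (R : realType) (f : R -> R) : Prop :=
  forall eps : R, 0 < eps ->
  exists2 eta : R, 0 < eta &
    forall (n : nat) (a b : 'I_n -> R),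
      (forall i, a i <= b i) ->
      trivIset [set: 'I_n] (fun i => `]a i, b i[%classic) ->
      \sum_(i < n) (b i - a i) < eta ->
      \sum_(i < n) `|f (b i) - f (a i)| < eps.

(* An absolutely continuous function has a derivative only almost everywhere;
   its derivative is any Borel function that agrees with it there. *)
Definition ae_derivative (R : realType) (f f' : R -> R) : Prop :=
  measurable_fun [set: R] f' /\
  {ae (@lebesgue_measure R), forall x : R, is_derive x 1 f (f' x)}.

(* [Y] is a version of E(X | W), W real-valued. [X] takes extended real values
   so that the mass of a random measure is allowed to be infinite on a null
   set. *)
Definition is_cond_expectation d (T : measurableType d) (R : realType)
    (P : probability T R) (W : T -> R) (X : T -> \bar R) (Y : T -> R) : Prop :=
  [/\ P.-integrable [set: T] X,
      P.-integrable [set: T] (EFin \o Y),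
      measurable_fun [set: g_sigma_algebra_preimageType W] Y &
      forall A : set T, g_sigma_algebra_preimage W A ->
        (\int[P]_(w in A) X w = \int[P]_(w in A) (Y w)%:E)%E].

(* Random positive measures on the real line are s-finite kernels from the
   sample space: this covers every kernel whose measures are all finite, and
   makes the integrals below measurable in [w]. *)
Definition random_integral d (T : measurableType d) (R : realType)
    (mu : R.-sfker T ~> R) (delta : R) (h : T -> R -> R) (w : T) : \bar R :=
  (\int[mu w]_(t in `[(- delta)%R, delta]%classic) (h w t)%:E)%E.

Definition random_mass d (T : measurableType d) (R : realType)
    (mu : R.-sfker T ~> R) (delta : R) : T -> \bar R :=
  random_integral mu delta (fun _ _ => 1).

(* The identity is required of those f only for which both sides exist. Hence
   it is implied by the variant in which existence of one side entails existence
   of the other, and by the variant for locally absolutely continuous f.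
   It does not depend on the version of f': applied to smooth compactly
   supported f, it forces the measure B |-> E mu {t | W + t \in B} to have a
   density. *)
Definition stein_identity d (T : measurableType d) (R : realType)
    (P : probability T R) (W Rem : {RV P >-> R}) (mu : R.-sfker T ~> R)
    (delta : R) : Prop :=
  forall f f' : R -> R, absolutely_continuous f -> ae_derivative f f' ->
    P.-integrable [set: T] (fun w => (W w * f (W w))%:E) ->
    {ae P, forall w, (mu w).-integrable `[(- delta)%R, delta]%classic
                       (fun t => (f' (W w + t))%:E)} ->
    P.-integrable [set: T]
      (random_integral mu delta (fun w t => f' (W w + t))) ->
    P.-integrable [set: T] (fun w => (Rem w * f (W w))%:E) ->
    (\int[P]_w (W w * f (W w))%:E =
       \int[P]_w random_integral mu delta (fun w t => f' (W w + t)%R) w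
       + \int[P]_w (Rem w * f (W w))%:E)%E.

Definition std_normal_cdf (R : realType) (x : R) : R :=
  fine (normal_prob 0 1 `]-oo, x]%classic).

(* The convention 0^(-1/3) = +oo; [powR] would give 0. *)
Definition inv_cube_root (R : realType) (a : R) : \bar R :=
  if a == 0 then +oo%E else (a `^ (- 3%:R^-1))%:E.

(* P(W > x) / (1 - Phi(x)) = 1 + O * theta^3 (1 + x^3) (delta + delta1 + delta2)
   with |O| <= C, in the range of x of the moderate deviation theorem. *)
Definition moderate_deviation_bound d (T : measurableType d) (R : realType)
    (P : probability T R) (W : {RV P >-> R})
    (delta delta1 delta2 theta C : R) : Prop :=
  forall x : R, 0 <= x ->
    (x%:E <= theta^-1%:E *
       mine (inv_cube_root delta)
            (mine (inv_cube_root delta1) (inv_cube_root delta2)))%E ->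
    exists2 r : R, `|r| <= C &
      fine (P [set w | W w > x]) / (1 - std_normal_cdf x) =
      1 + r * theta ^+ 3 * (1 + x ^+ 3) * (delta + delta1 + delta2).

(* Main.v *)
Require Import Defs.
From HB Require Import structures.
From mathcomp Require Import all_boot all_order all_algebra.
From mathcomp Require Import all_classical all_reals all_analysis.
From mathcomp Require Import measurable_realfun.
From mathcomp Require Import ring lra.

Set Implicit Arguments.
Unset Strict Implicit.
Unset Printing Implicit Defensive.

Import Order.TTheory GRing.Theory Num.Theory.
Import numFieldNormedType.Exports.

Local Open Scope classical_set_scope.
Local Open Scope ring_scope.

(** Write [D] and [r] for the values of the conditional expectations of the
    mass and of the remainder, and let [e] be of the order of
    [delta + delta1 + delta2].  Since [theta >= 1], the range of [x] forces
    [x^3 e <= 4], and it is enough to prove that the relative error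
    [P(W > x) / (1 - Phi x) - 1] is at most a constant times [e (1 + x^3)].
    If [e] is bounded below, then [x] is bounded and so is the ratio
    ([relative_error_bounded_range]); so let [e] be small.

    The Stein identity is used as an inequality ([stein_inequality]).  If
    [f' (w + t) <= G w] for all [|t| <= delta], then the identity for [f] gives
    [E (W f W) <= E (D G W) + E (r f W)], an inequality between functions of
    [W] alone, which is checked pointwise in [w], [D] and [r].  It is applied
    to three kinds of test functions.

    First, let [f] be the solution of the Stein equation
    [f' w = w f w + (1 - Phi y) - 1(w > y)].  Over a distance [e] the product
    [w f w] varies little ([stein_product_variation]), while the indicator is
    monotone: [1(w + t > y) >= 1(w > y + e)].  The inequality thus bounds
    [P(W > y + e)] by [1 - Phi y] plus an error, and with [- f] it bounds
    [P(W > y - e)] from below ([tail_upper_bound], [tail_lower_bound]).  Taking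
    [y = x - e] and [y = x + e] puts [P(W > x)] between the normal tails at
    [x - e] and [x + e], up to these errors.  Replacing the indicator by a
    shifted one costs nothing, so that [W] need not be known in advance to put
    little mass near [x].  The normal tail itself changes by a factor
    [1 + O(e (1 + x^3))] under the shift.

    With [V] the value of [W] clamped to the interval from [0] to [x], the
    errors are at most [(1 - Phi y) e] times the mean of
    [(1 + |W|) (1 + V) exp(V^2 / 2)].  This rests on bounds for the Mills ratio,
    through which the Stein solution is expressed.  It remains to see that this
    mean is [O(1 + x^3)] ([mean_moment_weight_le]).

    The second test function is [exp(V^2 / 2 - k V^3)] with [k] of order
    [(20 + x)^-3].  On the interval from [0] to [x] the cubic term is bounded,
    so it changes the exponential by a constant factor only; but it turns
    [f' = u f] into [f' = (u - 3 k u^2) f].  The negative term [- 3 k u^2 f]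
    absorbs all errors, which are [O(e (1 + u^2) f)], because [e] is small
    compared with [k].  What is left of it gives
    [k E (W^+ V exp(V^2 / 2 - k V^3)) = O(1 + E |W|)] ([tilted_moment]), and
    [1 / k] is [O(1 + x^3)].

    Finally, [E |W|] is bounded by means of the test functions
    [w / (1 + b w^2)], as [b] tends to [0] ([truncated_second_moment]).

    Both alternatives on the remainder yield [|r| <= 2 delta2 (1 + w^2)], and
    [|r| <= 2 delta2 + al |w|] for some [al < 1].  The first bound enters the
    errors of the Stein solution, and is small compared with the drift for [w]
    between [0] and [x + e]; the second one keeps [- w f w] dominant for larger
    [|w|]. *)

(** * Absolute continuity of piecewise smooth functions *)

(** Induction on the list of exceptional points: one that lies inside the
    interval splits it in two. The test functions to come are piecewise
    smooth. *)
Lemma mean_value_ineq (R : realType) (f f' : R -> R) (cs : seq R) (B a b : R) :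
  continuous f -> a <= b ->
  (forall z, a < z < b -> z \notin cs -> is_derive z 1 f (f' z) /\ `|f' z| <= B) ->
  `|f b - f a| <= B * (b - a).
Proof.
move=> cf; elim: cs a b => [|c cs IH] a b ab df.
  have df' z : z \in `]a, b[ -> is_derive z 1 f (f' z).
    by rewrite in_itv /= => zab; have [] := df z zab isT.
  move: ab; rewrite le_eqVlt => /predU1P[<-|ltab].
    by rewrite !subrr normr0 mulr0.
  have [|z zab ->] := MVT ltab df'; first by apply: continuous_subspaceT.
  move: zab; rewrite in_itv /= => zab.
  rewrite normrM (@gtr0_norm _ (b - a)) ?subr_gt0// ler_pM2r ?subr_gt0//.
  by have [] := df z zab isT.
have [/andP[ac cb]|ncab] := boolP (a < c < b).
  have h1 : `|f c - f a| <= B * (c - a).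
    apply: IH => [|z /andP[az zc] zcs]; first exact: ltW.
    by apply: df; rewrite ?az ?(lt_trans zc cb)// inE negb_or zcs lt_eqF.
  have h2 : `|f b - f c| <= B * (b - c).
    apply: IH => [|z /andP[cz zb] zcs]; first exact: ltW.
    by apply: df; rewrite ?zb ?(lt_trans ac cz)// inE negb_or zcs gt_eqF.
  have -> : f b - f a = (f b - f c) + (f c - f a) by ring.
  rewrite (le_trans (ler_normD _ _))//; lra.
apply: IH => // z zab zcs; apply: df => //; rewrite inE negb_or zcs andbT.
by apply: contraNneq ncab => <-.
Qed.

Lemma lipschitz_absolutely_continuous (R : realType) (f : R -> R) (L : R) :
  (forall a b, a <= b -> `|f b - f a| <= L * (b - a)) ->
  absolutely_continuous f.
Proof.
move=> lip eps eps0.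
have L1 : 0 < `|L| + 1 by rewrite ltr_wpDl.
exists (eps / (`|L| + 1)) => [|n a b ab _ sab]; first by rewrite divr_gt0.
apply: (@le_lt_trans _ _ (\sum_(i < n) (`|L| + 1) * (b i - a i))).
  apply: ler_sum => i _; rewrite (le_trans (lip _ _ (ab i)))//.
  by rewrite ler_wpM2r ?subr_ge0// (le_trans (ler_norm _))// lerDl.
by rewrite -mulr_sumr mulrC -ltr_pdivlMr.
Qed.

Lemma ae_derivative_off_seq (R : realType) (f f' : R -> R) (cs : seq R) :
  measurable_fun [set: R] f' ->
  (forall z, z \notin cs -> is_derive z 1 f (f' z)) -> ae_derivative f f'.
Proof.
move=> mf' df; split=> //.
exists [set` cs]; split.
- exact/countable_measurable/finite_set_countable/finite_seq.
- exact/countable_lebesgue_measure0/finite_set_countable/finite_seq.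
- by move=> z /= nd; apply/negPn/negP => zcs; exact/nd/df.
Qed.

(** * Means of functions of a random variable *)

Section integral_tools.
Context {d} {T : measurableType d} {R : realType}.
Variable P : probability T R.

Lemma bounded_of_norm_le {U : Type} (A : set U) (h : U -> R) (B : R) :
  (forall w, `|h w| <= B) -> [bounded h w | w in A].
Proof.
move=> hB; exists B; split => [|M BM w _ /=]; first exact: num_real.
exact: le_trans (hB w) (ltW BM).
Qed.

Lemma integrableM_bounded (X h : T -> R) (B : R) :
  P.-integrable [set: T] (EFin \o X) -> measurable_fun [set: T] h ->
  (forall w, `|h w| <= B) -> P.-integrable [set: T] (fun w => (X w * h w)%:E).
Proof.
move=> iX mh hB; have := integrableMl measurableT iX mh (bounded_of_norm_le _ hB).
by apply: eq_integrable => // w _; rewrite /= EFinM.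
Qed.

Lemma integrable_bounded (h : T -> R) (B : R) :
  measurable_fun [set: T] h -> (forall w, `|h w| <= B) ->
  P.-integrable [set: T] (EFin \o h).
Proof.
move=> mh hB; apply: measurable_bounded_integrable => //; last exact: bounded_of_norm_le hB.
exact: (le_lt_trans (probability_le1 P measurableT) (ltry 1)).
Qed.

Lemma ae_le_Rintegral (f g : T -> R) :
  P.-integrable [set: T] (EFin \o f) -> P.-integrable [set: T] (EFin \o g) ->
  {ae P, forall w, f w <= g w} -> \int[P]_w f w <= \int[P]_w g w.
Proof.
move=> intf intg [N [mN PN sN]].
have mC : measurable (~` N) by exact: measurableC.
have sub h : P.-integrable [set: T] (EFin \o h) ->
    \int[P]_w h w = \int[P]_(w in ~` N) h w.
  move=> ih; rewrite /Rintegral (negligible_integral mN measurableT ih PN).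
  by rewrite setTD.
rewrite sub// [leRHS]sub//; apply: le_Rintegral => //.
- exact: integrableS intf.
- exact: integrableS intg.
- by move=> w Nw; apply: contra_notP Nw => fg; exact: sN.
Qed.

Lemma Rintegral_cst1 (c : R) : \int[P]_(_ in [set: T]) c = c.
Proof.
rewrite Rintegral_cst// (_ : fine _ = 1) ?mulr1//.
exact: (congr1 fine (probability_setT P)).
Qed.

Import HBNNSimple.

(** [G] is approximated from below by simple functions, for which the claim is
    the hypothesis on [Z]; dominated convergence applies with the bound
    [`|Z| * B]. *)
Lemma integralM_comp_eq0_ge0 (W : {RV P >-> R}) (Z : T -> R) (G : R -> R) (B : R) :
  P.-integrable [set: T] (EFin \o Z) ->
  (forall A, measurable A -> \int[P]_(w in W @^-1` A) Z w = 0) ->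
  measurable_fun [set: R] G -> (forall r, 0 <= G r <= B) ->
  \int[P]_w (Z w * G (W w)) = 0.
Proof.
move=> iZ Z0 mG G0B.
have mW : measurable_fun [set: T] W by [].
have mEG : measurable_fun [set: R] (EFin \o G) by exact/measurable_EFinP.
pose s := nnsfun_approx measurableT mEG.
have sG n r : 0 <= s n r <= G r.
  rewrite fun_ge0 /= -lee_fin /s nnsfun_approxE le_approx// => x _.
  by rewrite lee_fin; case/andP: (G0B x).
have sB n w : `|s n (W w)| <= B.
  have /andP[s0 sg] := sG n (W w); rewrite ger0_norm//.
  by rewrite (le_trans sg)//; case/andP: (G0B (W w)).
have ms n : measurable_fun [set: T] (fun w => s n (W w)).
  by apply: measurableT_comp.
have iZi (A : set R) : measurable A ->
    P.-integrable [set: T] (fun w => (Z w * \1_A (W w))%:E).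
  move=> mA; apply: (@integrableM_bounded Z _ 1) => //.
    by apply: measurableT_comp => //; exact: measurable_indic.
  by move=> w; rewrite indicE; case: (_ \in _); rewrite ?normr1 ?normr0.
have Zs0 n : \int[P]_w (Z w * s n (W w)) = 0.
  have [K [c Ec]] : exists K (c : 'I_K -> R), forall r,
      s n r = \sum_(i < K) (c i * \1_(s n @^-1` [set c i]) r).
    by eexists; eexists => r; rewrite {1}(fimfunEord (s n) r); reflexivity.
  have E w : Z w * s n (W w) =
      \sum_(i < K) (c i * (Z w * \1_(s n @^-1` [set c i]) (W w))).
    by rewrite {1}Ec mulr_sumr; apply: eq_bigr => i _; rewrite mulrCA.
  rewrite /Rintegral; under eq_integral do rewrite E -sumEFin.
  rewrite integral_sum//; last first.
    move=> i; have := @integrableZl _ _ _ P _ measurableT (c i) _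
       (iZi _ (measurable_funPTI (s n) (measurable_set1 (c i)))).
    by apply: eq_integrable => // w _; rewrite EFinM.
  rewrite big1// => i _.
  have mA : measurable (s n @^-1` [set c i]) by exact: measurable_funPTI.
  under eq_integral do rewrite EFinM.
  rewrite integralZl//; last exact: iZi.
  set A := s n @^-1` _ in mA *.
  have <- : (\int[P]_(w in W @^-1` A) (Z w)%:E = \int[P]_w (Z w * \1_A (W w))%:E)%E.
    rewrite [LHS]integral_mkcond; apply: eq_integral => w _; rewrite patchE indicE.
    rewrite (_ : (w \in W @^-1` A) = (W w \in A)); last first.
      by apply/idP/idP; rewrite !inE.
    by case: ifPn; rewrite ?mulr1 ?mulr0.
  have mWA : measurable (W @^-1` A) by rewrite -[_ @^-1` _]setTI; exact: mW.
  have := Z0 _ mA; rewrite /Rintegral => ZA.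
  rewrite -[X in (_ * X)%E]fineK ?ZA ?mule0//.
  by apply: integrable_fin_num => //; exact: integrableS iZ.
have iZG : P.-integrable [set: T] (fun w => (Z w * G (W w))%:E).
  apply: (@integrableM_bounded Z _ B) => //; first exact: measurableT_comp.
  by move=> w; have /andP[? ?] := G0B (W w); rewrite ger0_norm.
have : (\int[P]_w (Z w * s n (W w))%:E @[n --> \oo] -->
        \int[P]_w (Z w * G (W w))%:E)%E.
  apply: (@dominated_cvg _ _ _ P _ measurableT _ _
           (fun w => (`|Z w| * B)%:E)) => //=.
  - by move=> n; exact/measurable_int/(integrableM_bounded _ (ms n) (sB n)).
  - move=> w _; apply: cvg_EFin; first by apply: nearW.
    rewrite /comp /=.
    apply: (@cvgM R _ \oo _ (cst (Z w)) (fun n => s n (W w))).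
      exact: cvg_cst.
    have -> : G (W w) = fine (EFin (G (W w))) by [].
    rewrite (_ : (fun n => s n (W w)) = (approx [set: R] (EFin \o G))^~ (W w)).
      apply: cvg_approx => //=; first by move=> x _; rewrite lee_fin; case/andP: (G0B x).
      by rewrite ltry.
    by apply/funext => n; rewrite /s nnsfun_approxE.
  - have := integrableZr measurableT B (integrable_norm iZ).
    by apply: eq_integrable => // w _; rewrite /= EFinM.
  - by move=> n w _; rewrite lee_fin normrM ler_wpM2l//.
rewrite /Rintegral => /cvg_lim <-//.
rewrite (_ : (fun n => _) = cst 0%E) ?lim_cst//.
apply/funext => n /=.
rewrite -[LHS]fineK; first by have := Zs0 n; rewrite /Rintegral => ->.
by apply: integrable_fin_num => //; exact: (integrableM_bounded _ (ms n) (sB n)).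
Qed.

(** Adding the constant [B] to [G] makes it nonnegative, and does not change
    the integral because [Z] has mean [0]. *)
Lemma integralM_comp_eq0 (W : {RV P >-> R}) (Z : T -> R) (G : R -> R) (B : R) :
  P.-integrable [set: T] (EFin \o Z) ->
  (forall A, measurable A -> \int[P]_(w in W @^-1` A) Z w = 0) ->
  measurable_fun [set: R] G -> (forall r, `|G r| <= B) ->
  \int[P]_w (Z w * G (W w)) = 0.
Proof.
move=> iZ Z0 mG GB.
have mGW : measurable_fun [set: T] (G \o W) by exact: measurableT_comp.
have B0 : 0 <= B by exact: le_trans (GB 0).
have iZG : P.-integrable [set: T] (fun w => (Z w * G (W w))%:E).
  exact: (integrableM_bounded iZ mGW (fun w => GB (W w))).
have := @integralM_comp_eq0_ge0 W Z (fun r => G r + B) (B + B) iZ Z0 _ _.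
rewrite (_ : (fun w => _) = fun w => Z w * G (W w) + B * Z w); last first.
  by apply/funext => w; ring.
have iBZ : P.-integrable [set: T] (fun w => (B * Z w)%:E).
  have := integrableZl measurableT B iZ.
  by apply: eq_integrable => // w _; rewrite EFinM.
rewrite RintegralD// RintegralZl//.
have := Z0 setT measurableT; rewrite preimage_setT => ->.
rewrite mulr0 addr0; apply; first exact: measurable_funD.
by move=> r; have := GB r; rewrite ler_norml => /andP[? ?]; apply/andP; split; lra.
Qed.

Lemma integrable_fine (X : T -> \bar R) :
  P.-integrable [set: T] X -> P.-integrable [set: T] (EFin \o (fine \o X)).
Proof.
move=> iX; apply: (le_integrable measurableT _ _ iX).
  apply/measurable_EFinP; apply: measurableT_comp => //.
  exact: measurable_int iX.
by move=> w _ /=; case: (X w) => [r||] //=; rewrite ?normr0 ?leey.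
Qed.

(** The definition of conditional expectation concerns events only; the step
    to bounded functions of [W] is [integralM_comp_eq0] for the difference of
    [X] and [Y]. *)
Lemma cond_expectation_pairing (W : {RV P >-> R}) (X : T -> \bar R) (Y : T -> R)
    (G : R -> R) (B : R) :
  is_cond_expectation P W X Y ->
  measurable_fun [set: R] G -> (forall r, `|G r| <= B) ->
  \int[P]_w (fine (X w) * G (W w)) = \int[P]_w (Y w * G (W w)).
Proof.
move=> [iX iY _ XY] mG GB.
have mGW : measurable_fun [set: T] (G \o W) by exact: measurableT_comp.
have iX' := integrable_fine iX.
have iXG := integrableM_bounded iX' mGW (fun w => GB (W w)).
have iYG := integrableM_bounded iY mGW (fun w => GB (W w)).
apply/eqP; rewrite -subr_eq0 -RintegralB//; apply/eqP.
under eq_Rintegral do rewrite -mulrBl.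
apply: (@integralM_comp_eq0 W (fun w => fine (X w) - Y w) G B) => //.
  have := integrableB measurableT iX' iY.
  by apply: eq_integrable => // w _; rewrite /= EFinB.
move=> A mA.
have mWA : measurable (W @^-1` A).
  by rewrite -[_ @^-1` _]setTI; exact: (measurable_funPT W).
rewrite RintegralB//; [|exact: integrableS iX'|exact: integrableS iY].
apply/eqP; rewrite subr_eq0; apply/eqP; congr fine.
rewrite -XY; last by exists A => //; rewrite setTI.
apply: ae_eq_integral => //.
- by apply: (@measurable_funS _ _ _ _ setT) => //; exact: measurable_int iX'.
- by apply: (@measurable_funS _ _ _ _ setT) => //; exact: measurable_int iX.
- apply: filterS (integrable_ae measurableT iX) => w + _ /=.
  by move=> /(_ Logic.I) Xfin; rewrite fineK.
Qed.

End integral_tools.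

(** * The Stein identity as an inequality *)

Section stein_inequality.
Context {d} {T : measurableType d} {R : realType}.
Variables (P : probability T R) (W Rem : {RV P >-> R}) (mu : R.-sfker T ~> R).
Variables (delta : R) (EDW ERW : T -> R).

Let I := `[(- delta)%R, delta]%classic.

(** An integral against an s-finite kernel is measurable when it extends over
    the whole line, so the interval goes into the integrand as an indicator. *)
Lemma measurable_random_integral_ge0 (h : T * R -> R) :
  measurable_fun [set: T * R] h -> (forall z, 0 <= h z) ->
  measurable_fun [set: T] (random_integral mu delta (fun w t => h (w, t))).
Proof.
move=> mh h0.
pose k (z : T * R) := (h z * \1_I z.2)%:E.
rewrite (_ : random_integral _ _ _ = fun w => (\int[mu w]_t k (w, t))%E).
  apply: measurable_fun_integral_sfinite_kernel.
    by move=> z; rewrite lee_fin mulr_ge0.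
  apply/measurable_EFinP; apply: measurable_funM => //.
  have mI : measurable_fun [set: R] (\1_I : R -> R) by apply: measurable_indic; exact: measurable_itv.
  exact: (measurableT_comp mI measurable_snd).
apply/funext => w; rewrite /random_integral integral_mkcond.
apply: eq_integral => t _; rewrite patchE /k indicE /=.
by case: ifPn => _; rewrite ?mulr1 ?mulr0.
Qed.

Lemma measurable_random_integral (h : T * R -> R) :
  measurable_fun [set: T * R] h ->
  measurable_fun [set: T] (random_integral mu delta (fun w t => h (w, t))).
Proof.
move=> mh.
rewrite (_ : random_integral _ _ _ = fun w =>
    (random_integral mu delta (fun w t => Num.max (h (w, t)) 0)%R w -
     random_integral mu delta (fun w t => Num.max (- h (w, t)) 0)%R w)%E).
  apply: emeasurable_funB.
    apply: (@measurable_random_integral_ge0 (fun z => Num.max (h z) 0)).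
      exact: measurable_maxr.
    by move=> z; rewrite le_max lexx orbT.
  apply: (@measurable_random_integral_ge0 (fun z => Num.max (- h z) 0)).
    by apply: measurable_maxr => //; exact: measurableT_comp.
  by move=> z; rewrite le_max lexx orbT.
apply/funext => w; rewrite /random_integral integralE; congr (_ - _)%E.
  by apply: eq_integral => t _; rewrite funeposE EFin_max.
by apply: eq_integral => t _; rewrite funenegE EFin_max EFinN.
Qed.

Hypothesis steinW : stein_identity W Rem mu delta.
Hypotheses (hEDW : is_cond_expectation P W (random_mass mu delta) EDW).
Hypotheses (hERW : is_cond_expectation P W (EFin \o Rem) ERW).

(** The bound [f' (W w + t) <= G (W w)] frees the derivative from the
    integral against the random measure: what remains is the mass times a
    function of [W]. Then the mass and [Rem] may be replaced by their
    conditional expectations. A bounded Lipschitz [f] satisfies the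
    integrability conditions of the identity, because the mass and [Rem] are
    integrable. *)
Lemma stein_inequality (f f' G : R -> R) (cs : seq R) (B : R) (H : T -> R) :
  continuous f -> (forall z, z \notin cs -> is_derive z 1 f (f' z)) ->
  measurable_fun [set: R] f' -> measurable_fun [set: R] G ->
  (forall z, `|f z| <= B) -> (forall z, `|f' z| <= B) -> (forall z, `|G z| <= B) ->
  P.-integrable [set: T] (fun w => (W w * f (W w))%:E) ->
  (forall w t, - delta <= t <= delta -> f' (w + t) <= G w) ->
  P.-integrable [set: T] (EFin \o H) ->
  {ae P, forall w, EDW w * G (W w) + ERW w * f (W w) - W w * f (W w) <= H w} ->
  0 <= \int[P]_w H w.
Proof.
move=> cf df mf' mG fB f'B GB iWf f'G iH DH.
have [iX iY _ _] := hEDW; have [iR iRY _ _] := hERW.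
have mf : measurable_fun [set: R] f by exact: continuous_measurable_fun.
have mfW : measurable_fun [set: T] (f \o W) by exact: measurableT_comp.
have mGW : measurable_fun [set: T] (G \o W) by exact: measurableT_comp.
have iRf := integrableM_bounded iR mfW (fun w => fB (W w)).
have iRYf := integrableM_bounded iRY mfW (fun w => fB (W w)).
have iXG := integrableM_bounded (integrable_fine iX) mGW (fun w => GB (W w)).
have iYG := integrableM_bounded iY mGW (fun w => GB (W w)).
have acf : absolutely_continuous f.
  apply: (@lipschitz_absolutely_continuous _ _ B) => a b ab.
  by apply: (@mean_value_ineq _ f f' cs) => // z _ zcs; split => //; exact: df.
have adf : ae_derivative f f' by exact: ae_derivative_off_seq df.
have mI : measurable I by exact: measurable_itv.
have mh : measurable_fun [set: T * R] (fun z => f' (W z.1 + z.2)).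
  apply: measurableT_comp => //; apply: measurable_funD => //.
  exact: measurableT_comp.
have mhw w : measurable_fun I (fun t => f' (W w + t)).
  apply: (@measurable_funS _ _ _ _ setT) => //; apply: measurableT_comp => //.
  exact: measurable_funD.
have massE w : random_mass mu delta w = mu w I.
  rewrite /random_mass /random_integral integral_cst// mul1e//.
pose phi := random_integral mu delta (fun w t => f' (W w + t)).
have mphi : measurable_fun [set: T] phi.
  exact: (@measurable_random_integral (fun z => f' (W z.1 + z.2))).
have finX : {ae P, forall w, mu w I \is a fin_num}.
  by apply: filterS (integrable_ae measurableT iX) => w /(_ Logic.I); rewrite massE.
have finphi w : mu w I \is a fin_num ->
    (mu w).-integrable I (fun t => (f' (W w + t))%:E).
  move=> fin; apply: measurable_bounded_integrable => //.
    by rewrite ltey_eq fin.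
  by apply: (@bounded_of_norm_le _ _ _ _ B) => t; exact: f'B.
have iphi : P.-integrable [set: T] phi.
  have iBX := integrableZl measurableT B iX.
  apply: (le_integrable measurableT mphi _ iBX) => w _.
  rewrite massE abseM (gee0_abs (measure_ge0 _ _)) /phi /random_integral.
  apply: le_trans (le_abse_integral _ mI _) _.
    by apply/measurable_EFinP; exact: mhw.
  rewrite -integral_cst//; apply: ge0_le_integral => //.
  - by apply/measurable_EFinP; apply: measurableT_comp => //; exact: mhw.
  - by move=> t _; rewrite lee_fin (le_trans (f'B _))// ler_norm.
have phiG : {ae P, forall w, fine (phi w) <=
    fine (random_mass mu delta w) * G (W w)}.
  apply: filterS finX => w fin.
  rewrite massE -lee_fin EFinM fineK; last first.
    by rewrite integrable_fin_num//; exact: finphi.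
  rewrite fineK// muleC -integral_cst//.
  apply: le_integral => //; first exact: finphi.
    apply: (measurable_bounded_integrable (f := cst (G (W w)))) => //.
      by rewrite ltey_eq fin.
    by apply: (@bounded_of_norm_le _ _ _ _ B) => t; exact: GB.
  by move=> t; rewrite inE /I /= in_itv /= => tI; rewrite lee_fin; exact: f'G.
have aefin : {ae P, forall w, (mu w).-integrable I (fun t => (f' (W w + t))%:E)}.
  by apply: filterS finX => w; exact: finphi.
have := steinW acf adf iWf aefin iphi iRf.
rewrite -/phi => idphi.
have {idphi}id : \int[P]_w (W w * f (W w)) =
    \int[P]_w (fine (phi w)) + \int[P]_w (Rem w * f (W w)).
  rewrite {1}/Rintegral idphi fineD; [|exact: integrable_fin_num..].
  congr (fine _ + _); apply: ae_eq_integral => //.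
    exact: measurable_int (integrable_fine iphi).
  apply: filterS (integrable_ae measurableT iphi) => w /(_ Logic.I) fin _.
  by rewrite fineK.
have le1 : \int[P]_w fine (phi w) <=
    \int[P]_w (fine (random_mass mu delta w) * G (W w)).
  by apply: ae_le_Rintegral => //; exact: integrable_fine.
have e1 := cond_expectation_pairing hEDW mG GB.
have e2 := cond_expectation_pairing hERW mf fB.
have le2 : \int[P]_w (EDW w * G (W w) + ERW w * f (W w) - W w * f (W w)) <=
    \int[P]_w H w.
  apply: ae_le_Rintegral => //.
  have := integrableB measurableT (integrableD measurableT iYG iRYf) iWf.
  by apply: eq_integrable => // w _; rewrite /= -EFinD -EFinB.
move: le2; rewrite RintegralB//; last first.
  have := integrableD measurableT iYG iRYf.
  by apply: eq_integrable => // w _; rewrite /= -EFinD.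
rewrite RintegralD// -e1 -e2 id; lra.
Qed.

End stein_inequality.

(** * Calculus rules for derivatives at a point *)

Section pointwise_derivatives.
Context {R : realType}.
Implicit Types (f g : R -> R) (x c : R).

Lemma is_deriveE f x df df' :
  is_derive x 1 f df -> df = df' -> is_derive x 1 f df'.
Proof. by move=> ? <-. Qed.

Lemma is_derive_add f g x df dg :
  is_derive x 1 f df -> is_derive x 1 g dg ->
  is_derive x 1 (fun w => f w + g w) (df + dg).
Proof. by move=> hf hg; exact: (is_deriveD hf hg). Qed.

Lemma is_derive_mul f g x df dg :
  is_derive x 1 f df -> is_derive x 1 g dg ->
  is_derive x 1 (fun w => f w * g w) (df * g x + f x * dg).
Proof.
move=> hf hg; apply: is_deriveE (is_deriveM hf hg) _.
by rewrite /GRing.scale /= addrC (mulrC (g x)).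
Qed.

Lemma is_derive_scale f x c df :
  is_derive x 1 f df -> is_derive x 1 (fun w => c * f w) (c * df).
Proof.
move=> hf; apply: is_deriveE (is_derive_mul (is_derive_cst c x 1) hf) _.
by rewrite mul0r add0r.
Qed.

Lemma is_derive_exp f x df :
  is_derive x 1 f df ->
  is_derive x 1 (fun w => expR (f w)) (df * expR (f x)).
Proof.
move=> hf; rewrite mulrC.
exact: (@is_derive1_comp _ expR f x _ _ (is_derive_expR (f x)) hf).
Qed.

Lemma is_derive_inv f x df : f x != 0 -> is_derive x 1 f df ->
  is_derive x 1 (fun w => (f w)^-1) (- df / f x ^+ 2).
Proof.
move=> fx0 hf; apply: is_deriveE (is_deriveV fx0 hf) _.
by rewrite /GRing.scale /= mulNr mulrC mulNr.
Qed.

Lemma is_derive_neg f x df :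
  is_derive x 1 f df -> is_derive x 1 (fun w => - f w) (- df).
Proof. by move=> hf; exact: (is_deriveN hf). Qed.

Lemma is_derive_idR x : is_derive x 1 (fun w : R => w) 1.
Proof. exact: is_derive_id. Qed.

Lemma is_derive_sqr x : is_derive x 1 (fun w : R => w ^+ 2) (2 * x).
Proof.
apply: is_deriveE (is_derive_mul (is_derive_idR x) (is_derive_idR x)) _; ring.
Qed.

Lemma is_derive_cube x : is_derive x 1 (fun w : R => w ^+ 3) (3 * x ^+ 2).
Proof.
apply: is_deriveE (is_derive_mul (is_derive_idR x) (is_derive_sqr x)) _; ring.
Qed.

Lemma is_derive_opp_arg f x df :
  is_derive (- x) 1 f df -> is_derive x 1 (fun w => f (- w)) (- df).
Proof.
move=> hf; have hN := is_derive_neg (is_derive_idR x).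
by apply: is_deriveE (@is_derive1_comp _ f _ x _ _ hf hN) _; rewrite mulrN1.
Qed.

Lemma is_derive_continuous f (df : R -> R) :
  (forall x : R, is_derive x 1 f (df x)) -> continuous f.
Proof.
by move=> hf x; apply/differentiable_continuous/derivable1_diffP; case: (hf x).
Qed.

Lemma mean_value f (df : R -> R) (a b : R) :
  a <= b -> (forall z : R, a <= z <= b -> is_derive z 1 f (df z)) ->
  exists2 c, a <= c <= b & f b - f a = df c * (b - a).
Proof.
move=> ab hf; have [z zab||c cab e] := @MVT_segment _ f df a b ab.
- by apply: hf; move: zab; rewrite in_itv /= => /andP[? ?]; rewrite !ltW.
- apply: derivable_within_continuous => z zab.
  by have [] := hf z; rewrite in_itv in zab.
- by exists c => //; move: cab; rewrite in_itv.
Qed.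

Lemma le_of_derive_ge0 f (df : R -> R) (a b : R) :
  a <= b -> (forall z : R, a <= z <= b -> is_derive z 1 f (df z)) ->
  (forall z, a <= z <= b -> 0 <= df z) -> f a <= f b.
Proof.
move=> ab hf df0; have [c cab e] := mean_value ab hf.
by rewrite -subr_ge0 e mulr_ge0 ?subr_ge0// df0.
Qed.

End pointwise_derivatives.

(** * The normal tail and its Mills ratio *)

Section gaussian_tail.
Context {R : realType}.
Local Notation Phi := (@std_normal_cdf R).
Local Notation pdf := (normal_pdf (0 : R) 1).
Implicit Types x y w z b : R.

Lemma std_normal_pdfE x : pdf x = normal_peak (1 : R) * expR (- 2^-1 * x ^+ 2).
Proof.
rewrite normal_pdfE ?oner_neq0// /normal_fun subr0 expr1n; congr (_ * expR _).
rewrite -[1 *+ 2]/2; ring.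
Qed.

Lemma normal_peak1_gt0 : 0 < normal_peak (1 : R).
Proof. by apply: normal_peak_gt0; exact: oner_neq0. Qed.

Lemma is_derive_std_normal_cdf x : is_derive x 1 Phi (pdf x).
Proof.
have [||||d1 d2] := @continuous_FTC1 _ pdf -oo%O x (x + 1).
- by rewrite ltrDl.
- by apply: (integrableS measurableT _ _ (integrable_normal_pdf 0 1)).
- by rewrite ltNyr.
- by apply: continuous_normal_pdf; exact: oner_neq0.
set F := (F in derivable F) in d1 d2.
have -> : Phi = F by apply/funext => z; rewrite /std_normal_cdf /normal_prob.
by rewrite derive1E in d2; exact: DeriveDef d1 d2.
Qed.

Lemma is_derive_std_normal_pdf x : is_derive x 1 pdf (- x * pdf x).
Proof.
have -> : pdf = fun w => normal_peak (1 : R) * expR (- 2^-1 * w ^+ 2).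
  by apply/funext => w; rewrite std_normal_pdfE.
apply: is_deriveE (is_derive_scale (normal_peak (1 : R))
  (is_derive_exp (is_derive_scale (- 2^-1) (is_derive_sqr x)))) _.
by field.
Qed.

(** The limits of [Phi] are those of the distribution function of the identity,
    seen as a random variable under the normal law. *)
Let idTR : measurableTypeR R -> R := idfun.

#[local] HB.instance Definition _ :=
  @isMeasurableFun.Build _ _ _ _ idTR (@measurable_id _ _ setT).

Lemma std_normal_cdf_cvgy : Phi x @[x --> +oo] --> (1 : R).
Proof.
exact: fine_cvg (@cvg_cdfy1 _ _ _ (normal_prob 0 1)
  (idTR : {RV (normal_prob 0 1) >-> R})).
Qed.

Lemma std_normal_cdf_cvgNy : Phi x @[x --> -oo] --> (0 : R).
Proof.
exact: fine_cvg (@cvg_cdfNy0 _ _ _ (normal_prob 0 1)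
  (idTR : {RV (normal_prob 0 1) >-> R})).
Qed.

Lemma std_normal_pdf_gt0 x : 0 < pdf x.
Proof. by rewrite std_normal_pdfE mulr_gt0 ?expR_gt0// normal_peak1_gt0. Qed.

Section tail.
Variable K : R -> R.
Hypothesis dK : forall x : R, is_derive x 1 K (- pdf x).
Hypothesis K0 : K x @[x --> +oo] --> (0 : R).

Lemma tail_small (e : R) : 0 < e -> exists b0, forall b, b0 < b -> `|K b| < e.
Proof.
move=> e0; have /cvgr0Pnorm_lt /(_ e e0)[M [_ MK]] := K0.
by exists M.
Qed.

(** The difference of the two sides increases, with derivative
    [2 * pdf z / (1 + z ^+ 2) ^+ 2], and vanishes at infinity; were
    it positive at [w], it would stay above this positive value. *)
Lemma tail_lower w : pdf w * (w / (1 + w ^+ 2)) <= K w.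
Proof.
pose f z := pdf z * (z / (1 + z ^+ 2)) - K z.
pose df z := pdf z * (2 / (1 + z ^+ 2) ^+ 2).
have pos z : 0 < 1 + z ^+ 2 by have := sqr_ge0 z; lra.
have hf (z : R) : is_derive z 1 f (df z).
  have h1 := @is_derive_inv _ (fun y => 1 + y ^+ 2) z _ (lt0r_neq0 (pos z))
    (is_derive_add (is_derive_cst (1 : R) z 1) (is_derive_sqr z)).
  have h2 := is_derive_mul (is_derive_std_normal_pdf z)
    (is_derive_mul (is_derive_idR z) h1).
  apply: is_deriveE (is_derive_add h2 (is_derive_neg (dK z))) _.
  by rewrite /df; field; rewrite lt0r_neq0.
rewrite -subr_le0 leNgt; apply/negP => c0; rewrite -/(f w) in c0.
have fw b : w <= b -> f w <= f b.
  move=> wb; apply: (le_of_derive_ge0 wb (fun z _ => hf z)) => z _.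
  by rewrite mulr_ge0 ?divr_ge0 ?sqr_ge0// ltW// std_normal_pdf_gt0.
have [b0 hb0] := tail_small (divr_gt0 c0 (ltr0Sn _ 1)).
pose s := normal_peak (1 : R).
have s0 : 0 < s := normal_peak1_gt0.
(* At [b], the tail is below [f w / 2] because [b0 < b], and the other term is
   at most [s / b <= f w / 2]. *)
pose b := Num.max 1 (Num.max w (Num.max (b0 + 1) (2 * s / f w))).
have b1 : 1 <= b by rewrite le_max lexx.
have bw : w <= b by rewrite !le_max lexx orbT.
have bb0 : b0 < b.
  by rewrite (@lt_le_trans _ _ (b0 + 1)) ?ltrDl// !le_max lexx !orbT.
have bs : 2 * s <= b * f w.
  by rewrite -ler_pdivrMr// !le_max lexx !orbT.
have := fw b bw; have := hb0 b bb0; rewrite ltr_norml => /andP[+ _].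
have pb : pdf b <= s by apply: normal_pdf_ub; exact: oner_neq0.
have : pdf b * (b / (1 + b ^+ 2)) <= s / b.
  rewrite ler_pdivlMr ?(lt_le_trans _ b1)//.
  have : b / (1 + b ^+ 2) * b <= 1.
    by rewrite mulrAC ler_pdivrMr ?pos// mul1r expr2; lra.
  have p0 := std_normal_pdf_gt0 b.
  by move=> h; rewrite -mulrA (le_trans _ pb)// ler_piMr// ltW.
have : s / b <= f w / 2.
  rewrite ler_pdivrMr ?(lt_le_trans _ b1)//; lra.
rewrite [f b]/f; lra.
Qed.

Lemma tail_gt0 w : 0 < K w.
Proof.
have K1 : 0 < K (Num.max w 1).
  have := tail_lower (Num.max w 1); apply: lt_le_trans.
  have m0 : 0 < Num.max w 1 by rewrite lt_max ltr01 orbT.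
  by rewrite mulr_gt0 ?std_normal_pdf_gt0// divr_gt0//; have := sqr_ge0 (Num.max w 1); lra.
apply: lt_le_trans K1 _; rewrite -lerN2.
apply: (@le_of_derive_ge0 _ (fun z => - K z) pdf); first by rewrite le_max lexx.
  by move=> z _; apply: is_deriveE (is_derive_neg (dK z)) _; rewrite opprK.
by move=> z _; rewrite ltW// std_normal_pdf_gt0.
Qed.

(** For [0 < w], the difference of [K] and [pdf / w] increases, with
    derivative [pdf z / z ^+ 2], and is asymptotically at most [0]. *)
Lemma tail_upper w : w * K w <= pdf w.
Proof.
have [w0|w0] := leP w 0.
  rewrite (@le_trans _ _ 0) ?(ltW (std_normal_pdf_gt0 w))//.
  by rewrite mulr_le0_ge0// ltW// tail_gt0.
pose f z := K z - pdf z * z^-1.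
pose df z := pdf z / z ^+ 2.
have hf (z : R) : w <= z -> is_derive z 1 f (df z).
  move=> wz; have z0 : z != 0 by rewrite gt_eqF// (lt_le_trans w0).
  have h := is_derive_mul (is_derive_std_normal_pdf z)
    (@is_derive_inv _ (fun y => y) z _ z0 (is_derive_idR z)).
  apply: is_deriveE (is_derive_add (dK z) (is_derive_neg h)) _.
  by rewrite /df; field.
rewrite mulrC -ler_pdivlMr// -subr_le0 leNgt; apply/negP => c0.
rewrite -/(f w) in c0.
have fw b : w <= b -> f w <= f b.
  move=> wb; apply: (le_of_derive_ge0 wb (df := df)) => z /andP[wz _].
    exact: hf.
  by rewrite divr_ge0 ?sqr_ge0// ltW// std_normal_pdf_gt0.
have [b0 hb0] := tail_small c0.
pose b := Num.max w (b0 + 1).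
have bw : w <= b by rewrite le_max lexx.
have bb0 : b0 < b.
  by rewrite (@lt_le_trans _ _ (b0 + 1)) ?ltrDl// le_max lexx orbT.
have := fw b bw; have := hb0 b bb0; rewrite ltr_norml => /andP[_].
have : 0 <= pdf b / b.
  by rewrite divr_ge0 ?(ltW (std_normal_pdf_gt0 b))// (le_trans (ltW w0)).
rewrite [f b]/f; lra.
Qed.

End tail.

Lemma is_derive_tail (x : R) : is_derive x 1 (fun w => 1 - Phi w) (- pdf x).
Proof.
apply: is_deriveE (is_derive_add (is_derive_cst (1 : R) x 1)
  (is_derive_neg (is_derive_std_normal_cdf x))) _.
by rewrite add0r.
Qed.

Lemma cvg_tail : 1 - Phi x @[x --> +oo] --> (0 : R).
Proof.
by rewrite -[X in _ --> X](subrr (1 : R)); apply: cvgB; [exact: cvg_cst|exact: std_normal_cdf_cvgy].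
Qed.

Lemma std_normal_pdfN x : pdf (- x) = pdf x.
Proof. by rewrite !std_normal_pdfE sqrrN. Qed.

(** The two sides have the same derivative, and both tend to [0] at infinity. *)
Lemma std_normal_cdfN x : Phi (- x) = 1 - Phi x.
Proof.
pose D z := Phi (- z) - (1 - Phi z).
have hD (z : R) : is_derive z 1 D 0.
  apply: is_deriveE (is_derive_add (is_derive_opp_arg (is_derive_std_normal_cdf (- z)))
    (is_derive_neg (is_derive_tail z))) _.
  by rewrite std_normal_pdfN; ring.
have cN : Phi (- z) @[z --> +oo] --> (0 : R).
  by have := std_normal_cdf_cvgNy; rewrite cvgNy_compNP.
have D0 : D z @[z --> +oo] --> (0 : R).
  by rewrite -[X in _ --> X](subrr (0 : R)); apply: cvgB cN cvg_tail.
have Dx b : x <= b -> D b = D x.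
  move=> xb; have [c _] := mean_value xb (fun z _ => hD z).
  by rewrite mul0r => /eqP; rewrite subr_eq0 => /eqP.
apply/eqP; rewrite -subr_eq0 -/(D x).
have DDx : D z @[z --> +oo] --> D x.
  apply: cvg_near_cst; exists x; split; first exact: num_real.
  by move=> z xz; rewrite Dx// ltW.
by rewrite (cvg_unique _ D0 DDx).
Qed.

End gaussian_tail.

Section mills_ratio.
Context {R : realType}.
Local Notation Phi := (@std_normal_cdf R).
Local Notation pdf := (normal_pdf (0 : R) 1).
Implicit Types x y w z b : R.

Definition mills_ratio (w : R) : R := (1 - Phi w) / pdf w.

Lemma mills_gt0 w : 0 < mills_ratio w.
Proof.
by rewrite divr_gt0 ?std_normal_pdf_gt0//; exact: (tail_gt0 is_derive_tail cvg_tail).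
Qed.

Lemma mills_lower w : w / (1 + w ^+ 2) <= mills_ratio w.
Proof.
rewrite ler_pdivlMr ?std_normal_pdf_gt0// mulrC.
exact: (tail_lower is_derive_tail cvg_tail).
Qed.

Lemma mills_upper w : w * mills_ratio w <= 1.
Proof.
rewrite mulrA ler_pdivrMr ?std_normal_pdf_gt0// mul1r.
exact: (tail_upper is_derive_tail cvg_tail).
Qed.

Lemma is_derive_mills w : is_derive w 1 mills_ratio (w * mills_ratio w - 1).
Proof.
have p0 := lt0r_neq0 (std_normal_pdf_gt0 w).
apply: is_deriveE (is_derive_mul (is_derive_tail w)
  (@is_derive_inv _ pdf w _ p0 (is_derive_std_normal_pdf w))) _.
by rewrite /mills_ratio; field.
Qed.

Lemma mills_addN w : mills_ratio w + mills_ratio (- w) = (pdf w)^-1.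
Proof.
rewrite /mills_ratio std_normal_pdfN std_normal_cdfN -mulrDl.
by rewrite subKr subrK mul1r.
Qed.

End mills_ratio.

(** * Small remainders and the second moment *)

Section regression_setting.
Context {d} {T : measurableType d} {R : realType}.
Variables (P : probability T R) (W Rem : {RV P >-> R}) (mu : R.-sfker T ~> R).
Variables (delta : R) (EDW ERW : T -> R).
Variables (e al : R).

(** The regime where one small number [e] dominates all errors. For large
    [|w|] the bound [sr_R2] would exceed the drift [- w]; [sr_R1] does not,
    since [al < 1]. The bound on [20 ^+ 3 * e] is what [tilt_rateP] asks
    for. *)
Record small_remainders : Prop := SmallRemainders {
  sr_al : 0 <= al < 1;
  sr_e_al : 8 * e <= 1 - al;
  sr_e : 20 ^+ 3 * e <= 1;
  sr_delta : 0 < delta <= e;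
  sr_stein : stein_identity W Rem mu delta;
  sr_EDW : is_cond_expectation P W (random_mass mu delta) EDW;
  sr_ERW : is_cond_expectation P W (EFin \o Rem) ERW;
  sr_D : {ae P, forall w, `|EDW w - 1| <= e * (1 + `|W w|)};
  sr_R2 : {ae P, forall w, `|ERW w| <= e * (1 + W w ^+ 2)};
  sr_R1 : {ae P, forall w, `|ERW w| <= e + al * `|W w|}
}.

Hypothesis small : small_remainders.

Lemma sr_e_gt0 : 0 < e.
Proof. by have /andP[d0 de] := sr_delta small; exact: lt_le_trans d0 de. Qed.

Lemma sr_e64 : 64 * e <= 1.
Proof.
apply: le_trans (sr_e small); rewrite ler_pM2r ?sr_e_gt0//.
by rewrite -natrX ler_nat.
Qed.

(** Reduction to one real variable: the inequality is to be checked for every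
    value [w] of [W] and all values [D], [r] which the bounds allow to the
    conditional expectations. *)
Lemma stein_pointwise (f f' G : R -> R) (cs : seq R) (B : R) (h : R -> R) :
  continuous f -> (forall z, z \notin cs -> is_derive z 1 f (f' z)) ->
  measurable_fun [set: R] f' -> measurable_fun [set: R] G ->
  (forall z, `|f z| <= B) -> (forall z, `|f' z| <= B) -> (forall z, `|G z| <= B) ->
  P.-integrable [set: T] (fun w => (W w * f (W w))%:E) ->
  (forall w t, - e <= t <= e -> f' (w + t) <= G w) ->
  P.-integrable [set: T] (fun w => (h (W w))%:E) ->
  (forall w D r, `|D - 1| <= e * (1 + `|w|) -> `|r| <= e * (1 + w ^+ 2) ->
     `|r| <= e + al * `|w| -> D * G w + r * f w - w * f w <= h w) ->
  0 <= \int[P]_w h (W w).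
Proof.
move=> cf df mf' mG fB f'B GB iWf f'G ih H.
have /andP[d0 de] := sr_delta small.
apply: (stein_inequality (sr_stein small) (sr_EDW small) (sr_ERW small)
  cf df mf' mG fB f'B GB iWf (H := fun w => h (W w))) => //.
  move=> w t /andP[t1 t2]; apply: f'G; apply/andP; split; lra.
apply: filterS3 (sr_D small) (sr_R2 small) (sr_R1 small) => w h1 h2 h3.
exact: H.
Qed.

Lemma integrable_bounded_comp (g : R -> R) (B : R) :
  measurable_fun [set: R] g -> (forall r, `|g r| <= B) ->
  P.-integrable [set: T] (fun w => (g (W w))%:E).
Proof.
move=> mg gB; apply: (@integrable_bounded _ _ _ P (g \o W) B).
  exact: measurableT_comp.
by move=> w; exact: gB.
Qed.

Lemma abs_le_1Dsqr (w : R) : `|w| <= 1 + w ^+ 2.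
Proof.
by rewrite -[w ^+ 2]real_normK ?num_real//; have := sqr_ge0 (`|w| - 1); nra.
Qed.

(** The test function is [w / (1 + b * w ^+ 2)], a bounded substitute
    for [w]. Its derivative near [w] is at most
    [2 / (1 + b * w ^+ 2)], and as [al < 1] the remainder term takes
    away only a fraction of the left-hand side. *)
Lemma truncated_second_moment (b : R) : 0 < b <= 1 ->
  \int[P]_w (W w ^+ 2 / (1 + b * W w ^+ 2)) <= 6 / (1 - al).
Proof.
move=> /andP[b0 b1].
have e_al := sr_e_al small; have e64 := sr_e64; have e_gt0 := sr_e_gt0.
have /andP[al0 al1] := sr_al small.
pose den (w : R) := 1 + b * w ^+ 2.
have den1 (w : R) : 1 <= den w by rewrite lerDl mulr_ge0 ?sqr_ge0// ltW.
have den0 (w : R) : 0 < den w by rewrite (lt_le_trans ltr01).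
pose f (w : R) := w / den w.
pose f' (w : R) := (1 - b * w ^+ 2) / den w ^+ 2.
pose G (w : R) := 2 / den w.
have cden : continuous den.
  by apply: (@is_derive_continuous _ _ (fun w => 0 + b * (2 * w))) => z;
    exact: is_derive_add (is_derive_cst (1 : R) z 1) (is_derive_scale b (is_derive_sqr z)).
have df (z : R) : is_derive z 1 f (f' z).
  apply: is_deriveE (is_derive_mul (is_derive_idR z)
    (@is_derive_inv _ den z _ (lt0r_neq0 (den0 z))
    (is_derive_add (is_derive_cst (1 : R) z 1) (is_derive_scale b (is_derive_sqr z))))) _.
  by rewrite /f' /den; field; rewrite lt0r_neq0// den0.
have mden : measurable_fun [set: R] den by exact: continuous_measurable_fun.
have miden : measurable_fun [set: R] (fun w => (den w)^-1).
  apply: continuous_measurable_fun => z; apply: cvgV; last exact: cden.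
  by rewrite lt0r_neq0.
have cf : continuous f by exact: is_derive_continuous df.
have mf' : measurable_fun [set: R] f'.
  rewrite (_ : f' = fun w => (2 - den w) * ((den w)^-1 * (den w)^-1)).
    by repeat apply: measurable_funM => //; exact: measurable_funB.
  by apply/funext => w; rewrite /f' /den -invfM -expr2; congr (_ * _); ring.
have mG : measurable_fun [set: R] G by exact: measurable_funM.
have ib0 : 0 < b^-1 by rewrite invr_gt0.
have abs1 := abs_le_1Dsqr.
have fabs (w : R) : `|f w| = `|w| / den w by rewrite normrM normfV (gtr0_norm (den0 w)).
have fB (w : R) : `|f w| <= 2 + b^-1.
  rewrite fabs (@le_trans _ _ b^-1) ?lerDr// ler_pdivrMr// -ler_pdivrMl ?invr_gt0// invrK.
  by have := abs1 w; have := sqr_ge0 w; rewrite /den; nra.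
have f'B (w : R) : `|f' w| <= 2 + b^-1.
  rewrite normrM normfV (@gtr0_norm _ (den w ^+ 2)) ?exprn_gt0//.
  rewrite ler_pdivrMr ?exprn_gt0// (@le_trans _ _ (den w ^+ 2)) ?ler_peMl ?sqr_ge0//; last lra.
  rewrite ler_norml /den; have := sqr_ge0 w; nra.
have GB (w : R) : `|G w| <= 2 + b^-1.
  rewrite ger0_norm; last by rewrite divr_ge0// ltW.
  apply: (@le_trans _ _ 2); last lra.
  by rewrite /G ler_pdivrMr// ler_peMr.
have wf (w : R) : w * f w = w ^+ 2 / den w by rewrite mulrA -expr2.
have wf0 (w : R) : 0 <= w * f w by rewrite wf divr_ge0 ?sqr_ge0 ?ltW.
have wfB (w : R) : `|w * f w| <= b^-1.
  rewrite ger0_norm// wf ler_pdivrMr// -ler_pdivrMl ?invr_gt0// invrK /den.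
  lra.
have mid : measurable_fun [set: R] (fun w : R => w) by exact: measurable_id.
have mf : measurable_fun [set: R] f by exact: continuous_measurable_fun.
have iwf : P.-integrable [set: T] (fun w => (W w * f (W w))%:E).
  by apply: (@integrable_bounded_comp (fun w => w * f w) b^-1) => //; exact: measurable_funM.
have ih : P.-integrable [set: T]
    (fun w => (2 + 5 * e - (1 - al - 3 * e) * (W w * f (W w)))%:E).
  apply: (@integrable_bounded_comp (fun w => 2 + 5 * e - (1 - al - 3 * e) * (w * f w))
    (`|2 + 5 * e| + `|1 - al - 3 * e| * b^-1)).
    by apply: measurable_funB => //; apply: measurable_funM => //; exact: measurable_funM.
  move=> w; rewrite (le_trans (ler_normB _ _))// lerD2l normrM.
  by rewrite ler_wpM2l.
have f'G (w t : R) : - e <= t <= e -> f' (w + t) <= G w.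
  move=> te.
  have t2 : t ^+ 2 <= 1 / 2.
    move: te => /andP[te1 te2].
    have : 0 <= (1 / 2 - t) * (1 / 2 + t) by apply: mulr_ge0; lra.
    nra.
  have dd : den w <= 2 * den (w + t).
    rewrite /den; have := sqr_ge0 (w + 2 * t); nra.
  rewrite /f' /G ler_pdivrMr ?exprn_gt0// mulrAC ler_pdivlMr//.
  have := den1 (w + t); have := den1 w.
  have : 1 - b * (w + t) ^+ 2 <= den (w + t).
    by rewrite /den; have := sqr_ge0 (w + t); nra.
  move: (den w) (den (w + t)) dd => p q; nra.
have := stein_pointwise cf (cs := [::]) (fun z _ => df z) mf' mG fB f'B GB iwf f'G
  (h := fun w => 2 + 5 * e - (1 - al - 3 * e) * (w * f w)) ih.
have E : \int[P]_w (2 + 5 * e - (1 - al - 3 * e) * (W w * f (W w))) =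
    2 + 5 * e - (1 - al - 3 * e) * \int[P]_w (W w * f (W w)).
  rewrite RintegralB// ?Rintegral_cst1 ?RintegralZl//.
  - exact: (@integrable_bounded _ _ _ P (cst _) (`|2 + 5 * e|)).
  - have := integrableZl measurableT (1 - al - 3 * e) iwf.
    by apply: eq_integrable => // w _; rewrite /= EFinM.
rewrite E => main.
rewrite (_ : \int[P]_w (_ / _) = \int[P]_w (W w * f (W w))); last first.
  by apply: eq_Rintegral => w _; rewrite wf.
rewrite ler_pdivlMr ?subr_gt0//.
have X0 : 0 <= \int[P]_w (W w * f (W w)) by apply: Rintegral_ge0 => w _.
apply: (@le_trans _ _ (2 * (2 + 5 * e))); last lra.
apply: (@le_trans _ _ (2 * ((1 - al - 3 * e) * \int[P]_w (W w * f (W w))))).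
  rewrite mulrA mulrC ler_wpM2r//; lra.
rewrite ler_pM2l// -subr_ge0 main// => {main E ih iwf} w D r hD _ hr.
have D1 : D <= 1 + e * (2 + w ^+ 2).
  by move: hD; rewrite ler_norml => /andP[_]; have := abs1 w; nra.
have DG : D * G w <= 2 * (1 + 2 * e) + 2 * e * (w * f w).
  have -> : 2 * (1 + 2 * e) + 2 * e * (w * f w) =
      (1 + e * (2 + w ^+ 2)) * G w + 2 * (1 + 2 * e) * (1 - (den w)^-1).
    by rewrite /G /f; field; rewrite lt0r_neq0.
  have G0 : 0 <= G w by rewrite divr_ge0// ltW.
  rewrite (@le_trans _ _ ((1 + e * (2 + w ^+ 2)) * G w)) ?ler_wpM2r// lerDl.
  rewrite mulr_ge0 ?subr_ge0 ?invf_le1//; lra.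
have rf : r * f w <= (e + al * `|w|) * `|f w|.
  by rewrite (le_trans (ler_norm _))// normrM ler_wpM2r.
have wfn : `|w| * `|f w| = w * f w by rewrite -normrM ger0_norm.
have fle : `|f w| <= 1 + w * f w.
  rewrite -wfn fabs; have [w1|w1] := leP `|w| 1.
    rewrite (@le_trans _ _ 1)//.
      by rewrite ler_pdivrMr// mul1r (le_trans w1).
    by rewrite lerDl !mulr_ge0// invr_ge0 ltW.
  rewrite (@le_trans _ _ (`|w| * (`|w| / den w)))// ?lerDr//.
  by rewrite ler_peMl ?ltW// divr_gt0// (lt_trans ltr01).
have : (e + al * `|w|) * `|f w| <= e * (1 + w * f w) + al * (w * f w).
  rewrite mulrDl -mulrA wfn lerD2r ler_pM2l//.
by move: (w * f w) (wf0 w) DG => X X0' DG; nra.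
Qed.
(** Monotone convergence, with [b = 1 / (n + 1)] in
    [truncated_second_moment]. *)
Lemma integral_sqr_le : (\int[P]_w (W w ^+ 2)%:E <= (6 / (1 - al))%:E)%E.
Proof.
have bn01 (n : nat) : 0 < (n.+1%:R^-1 : R) <= 1.
  by rewrite invr_gt0 ltr0Sn invf_le1 ?ltr0Sn// ler1n.
have den0 (n : nat) (w : R) : 0 < 1 + n.+1%:R^-1 * w ^+ 2.
  by rewrite ltr_pwDl// mulr_ge0 ?sqr_ge0.
pose g (n : nat) (w : T) := (W w ^+ 2 / (1 + n.+1%:R^-1 * W w ^+ 2))%:E.
have mW2 : measurable_fun [set: T] (fun w => W w ^+ 2) by exact: measurable_funX.
have mdenR n : measurable_fun [set: R] (fun r : R => (1 + n.+1%:R^-1 * r ^+ 2)^-1).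
  apply: continuous_measurable_fun => r; apply: cvgV; first by rewrite lt0r_neq0.
  apply: (@is_derive_continuous _ (fun z => 1 + n.+1%:R^-1 * z ^+ 2)
    (fun z => 0 + n.+1%:R^-1 * (2 * z))) => z.
  exact: is_derive_add (is_derive_cst (1 : R) z 1) (is_derive_scale _ (is_derive_sqr z)).
have mden n : measurable_fun [set: T] (fun w => (1 + n.+1%:R^-1 * W w ^+ 2)^-1).
  exact: measurableT_comp (mdenR n) _.
have mg n : measurable_fun [set: T] (g n).
  by apply/measurable_EFinP; exact: measurable_funM.
have g0 n w : (0 <= g n w)%E by rewrite lee_fin divr_ge0 ?sqr_ge0// ltW.
have gnd w : [set: T] w -> {homo (fun n => g n w) : n m / (n <= m)%N >-> (n <= m)%E}.
  move=> _ n m nm; rewrite lee_fin ler_wpM2l ?sqr_ge0// lef_pV2 ?posrE//.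
  by rewrite lerD2l ler_wpM2r ?sqr_ge0// lef_pV2 ?posrE// ler_nat ltnS.
have glim w : limn (fun n => g n w) = (W w ^+ 2)%:E.
  apply/cvg_lim => //; apply: cvg_EFin; first by apply: nearW.
  rewrite /comp /= -[X in _ --> X]divr1.
  apply: cvgM; first exact: cvg_cst.
  apply: cvgV; first exact: oner_neq0.
  rewrite -[X in _ --> X]addr0; apply: cvgD; first exact: cvg_cst.
  rewrite -[X in _ --> X](mul0r (W w ^+ 2)).
  by apply: cvgM; [exact: cvg_harmonic|exact: cvg_cst].
have := @monotone_convergence _ _ _ P _ measurableT g mg (fun n w _ => g0 n w) gnd.
under eq_integral do rewrite glim.
move=> ->; apply: lime_le.
  apply: ereal_nondecreasing_is_cvgn => n m nm; apply: ge0_le_integral => //.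
  by move=> w _; exact: gnd.
apply: nearW => n; rewrite -[X in (X <= _)%E]fineK.
  by rewrite lee_fin; exact: truncated_second_moment.
apply: integrable_fin_num => //.
apply: (@integrable_bounded_comp (fun w => w ^+ 2 / (1 + n.+1%:R^-1 * w ^+ 2)) n.+1%:R).
  by apply: measurable_funM => //; exact: measurable_funX.
move=> r; rewrite ger0_norm ?divr_ge0 ?sqr_ge0// ?(ltW (den0 _ _))//.
by rewrite ler_pdivrMr// mulrDr mulr1 mulrA mulfV ?pnatr_eq0// mul1r lerDr.
Qed.

Lemma integrable_sqr : P.-integrable [set: T] (EFin \o (fun w => W w ^+ 2)).
Proof.
apply/integrableP; split.
  by apply/measurable_EFinP; exact: measurable_funX.
apply: le_lt_trans (ltry (6 / (1 - al))).
under eq_integral do rewrite /= ger0_norm ?sqr_ge0//.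
exact: integral_sqr_le.
Qed.

Lemma integrable_1Dsqr : P.-integrable [set: T] (EFin \o (fun w => 1 + W w ^+ 2)).
Proof.
have i1 : P.-integrable [set: T] (EFin \o cst 1).
  exact: (@integrable_bounded _ _ _ P (cst 1) `|1|).
by have := integrableD measurableT i1 integrable_sqr; exact: eq_integrable.
Qed.

Lemma integrable_W : P.-integrable [set: T] (EFin \o W).
Proof.
apply: (le_integrable measurableT _ _ integrable_1Dsqr); first exact/measurable_EFinP.
move=> w _; rewrite lee_fin (@ger0_norm _ (1 + _)) ?abs_le_1Dsqr//.
by rewrite addr_ge0 ?sqr_ge0.
Qed.

Lemma mean_abs_le : \int[P]_w `|W w| <= 1 + 6 / (1 - al).
Proof.
apply: (@le_trans _ _ (\int[P]_w (1 + W w ^+ 2))).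
  apply: le_Rintegral => //.
  - exact: integrable_norm integrable_W.
  - exact: integrable_1Dsqr.
  - by move=> w _; exact: abs_le_1Dsqr.
rewrite RintegralD//; [|exact: (@integrable_bounded _ _ _ P (cst 1) `|1|)|exact: integrable_sqr].
rewrite Rintegral_cst1 lerD2l -lee_fin /Rintegral fineK; first exact: integral_sqr_le.
exact: integrable_fin_num integrable_sqr.
Qed.

End regression_setting.

(** * The tilted exponential *)

Lemma expR_le_1D2x {R : realType} (y : R) : 0 <= y <= 2^-1 -> expR y <= 1 + 2 * y.
Proof.
move=> /andP[y0 y1].
have h1 : 1 - y <= expR (- y) by exact: expR_ge1Dx.
have h2 : 0 < expR y := expR_gt0 y.
have h3 : expR y * expR (- y) = 1 by rewrite expRN mulfV// lt0r_neq0.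
have : expR y * (1 - y) <= expR y * expR (- y) by rewrite ler_pM2l.
rewrite h3.
have : 0 <= y * (1 - 2 * y) by apply: mulr_ge0; lra.
nra.
Qed.

Section weighted_exponential.
Context {R : realType}.
Implicit Types (k u w x e D r : R).

(** Without the cubic term this is, up to a constant, the reciprocal of the
    normal density, which solves [f' u = u * f u]. The cubic term adds
    [- 3 * k * u ^+ 2 * f u] on the right. *)
Definition tilt k u : R := expR (u ^+ 2 / 2 - k * u ^+ 3).
Definition tilt' k u : R := (u - 3 * k * u ^+ 2) * tilt k u.
Definition clamp x w : R := Num.max 0 (Num.min w x).

(** The supremum over [|t| <= e] of the derivative of
    [tilt k \o clamp x] at [w + t], or a bound for it: this derivative
    increases on the interval from [0] to [x] ([tilt'_incr]) and vanishes
    outside. *)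
Definition tilt_bound k x e w : R :=
  if w <= x + e then tilt' k (clamp x (w + e)) else 0.

Lemma tilt_gt0 k u : 0 < tilt k u. Proof. exact: expR_gt0. Qed.

Lemma is_derive_tilt k u : is_derive u 1 (tilt k) (tilt' k u).
Proof.
have h : is_derive u 1 (fun w => w ^+ 2 / 2 - k * w ^+ 3) (u - 3 * k * u ^+ 2).
  have h1 := is_derive_scale (2^-1) (is_derive_sqr u).
  have h2 := is_derive_neg (is_derive_scale k (is_derive_cube u)).
  have := is_derive_add h1 h2.
  rewrite (_ : (fun w => _) = (fun w => w ^+ 2 / 2 - k * w ^+ 3)); last first.
    by apply/funext => w; rewrite mulrC.
  by move=> h; apply: is_deriveE h _; field.
exact: is_derive_exp h.
Qed.

Lemma tilt_incr k x u w : 0 <= k -> 6 * k * x <= 1 -> 0 <= u -> u <= w -> w <= x ->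
  tilt k u <= tilt k w.
Proof.
move=> k0 kx u0 uw wx; rewrite ler_expR -subr_ge0.
have -> : w ^+ 2 / 2 - k * w ^+ 3 - (u ^+ 2 / 2 - k * u ^+ 3) =
    (w - u) * ((w + u) / 2 - k * (w ^+ 2 + w * u + u ^+ 2)) by field.
have kw : 6 * (k * w) <= 1.
  by rewrite (le_trans _ kx)// -mulrA ler_pM2l// ler_wpM2l.
have kw0 : 0 <= k * w by rewrite mulr_ge0// (le_trans u0).
apply: mulr_ge0; first lra.
have : k * (w ^+ 2 + w * u + u ^+ 2) <= k * w * (w + u + u).
  rewrite -subr_ge0 (_ : _ - _ = k * (u * (w - u))); last by ring.
  by rewrite !mulr_ge0// subr_ge0.
have : 0 <= (1 - 6 * (k * w)) * (w + u + u) by apply: mulr_ge0; lra.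
move: (k * (w ^+ 2 + w * u + u ^+ 2)) => q; nra.
Qed.

Lemma drift_ge0 k x u : 0 <= k -> 6 * k * x <= 1 -> 0 <= u <= x ->
  0 <= u - 3 * k * u ^+ 2.
Proof.
move=> k0 kx /andP[u0 ux].
have : k * u <= k * x by rewrite ler_wpM2l.
move=> h; have : 0 <= u * (1 - 3 * (k * u)) by apply: mulr_ge0; lra.
lra.
Qed.

Lemma drift_incr k x u w : 0 <= k -> 6 * k * x <= 1 -> 0 <= u -> u <= w -> w <= x ->
  u - 3 * k * u ^+ 2 <= w - 3 * k * w ^+ 2.
Proof.
move=> k0 kx u0 uw wx; rewrite -subr_ge0.
rewrite (_ : _ - _ = (w - u) * (1 - 3 * (k * w) - 3 * (k * u))); last by ring.
have h1 : k * w <= k * x by rewrite ler_wpM2l.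
have h2 : k * u <= k * x by rewrite ler_wpM2l// (le_trans uw).
apply: mulr_ge0; lra.
Qed.

Lemma tilt'_ge0 k x u : 0 <= k -> 6 * k * x <= 1 -> 0 <= u <= x -> 0 <= tilt' k u.
Proof. by move=> k0 kx ux; rewrite mulr_ge0 ?(drift_ge0 k0 kx)// ltW// tilt_gt0. Qed.

Lemma tilt'_incr k x u w : 0 <= k -> 6 * k * x <= 1 -> 0 <= u -> u <= w -> w <= x ->
  tilt' k u <= tilt' k w.
Proof.
move=> k0 kx u0 uw wx; apply: ler_pM.
- by rewrite (drift_ge0 k0 kx)// u0 (le_trans uw).
- by rewrite ltW// tilt_gt0.
- exact: drift_incr kx _ _ _.
- exact: tilt_incr kx _ _ _.
Qed.

Lemma tilt_le2 k u : 0 <= k -> 0 <= u <= 1 -> tilt k u <= 2.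
Proof.
move=> k0 /andP[u0 u1]; apply: (@le_trans _ _ (expR 2^-1)).
  rewrite ler_expR; have : 0 <= k * u ^+ 3 by rewrite mulr_ge0// exprn_ge0.
  have : 0 <= (1 - u) * (1 + u) by apply: mulr_ge0; lra.
  nra.
have := @expR_le_1D2x R 2^-1; rewrite lexx invr_ge0 ler0n /= => /(_ isT); lra.
Qed.

(** For [u <= 1] the tilt is at most [2]; for [1 < u] the constant [c] is
    at most [k * u ^+ 2]. *)
Lemma tilt_absorb k u c : 0 <= c <= k -> c <= 1 -> 0 <= u ->
  c * tilt k u <= 2 + k * u ^+ 2 * tilt k u.
Proof.
move=> /andP[c0 ck] c1 u0; have k0 := le_trans c0 ck; have T0 := tilt_gt0 k u.
have [u1|u1] := leP u 1.
  have : tilt k u <= 2 by apply: tilt_le2 => //; rewrite u0.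
  have : 0 <= k * u ^+ 2 * tilt k u by rewrite !mulr_ge0// ltW.
  have : c * tilt k u <= 1 * tilt k u by rewrite ler_pM2r.
  lra.
have : c * tilt k u <= k * u ^+ 2 * tilt k u; last lra.
by rewrite ler_pM2r// (le_trans ck)// ler_peMr// exprn_ege1// ltW.
Qed.

(** The exponent grows at most by [w * e + e ^+ 2 / 2], and the
    exponential of such a small number is at most [1] plus twice that number. *)
Lemma tilt_growth k e w u : 0 <= k -> 0 <= e -> 0 <= w <= u -> u <= w + e ->
  w * e + e ^+ 2 / 2 <= 2^-1 -> tilt k u <= tilt k w * (1 + (2 * w * e + e ^+ 2)).
Proof.
move=> k0 e0 /andP[w0 wu] ue we.
have y0 : 0 <= w * e + e ^+ 2 / 2.
  by rewrite addr_ge0// ?mulr_ge0// exprn_ge0.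
have := @expR_le_1D2x R (w * e + e ^+ 2 / 2); rewrite y0 we => /(_ isT).
rewrite (_ : 2 * _ = 2 * w * e + e ^+ 2); last by field.
move=> h; apply: (@le_trans _ _ (tilt k w * expR (w * e + e ^+ 2 / 2))); last first.
  by rewrite ler_pM2l// tilt_gt0.
rewrite -expRD ler_expR.
have h3 : w ^+ 3 <= u ^+ 3 by rewrite lerXn2r// nnegrE// (le_trans w0).
have h2 : u ^+ 2 <= (w + e) ^+ 2 by rewrite lerXn2r// nnegrE// ?addr_ge0// (le_trans w0).
have : k * w ^+ 3 <= k * u ^+ 3 by rewrite ler_wpM2l.
move: (k * w ^+ 3) (k * u ^+ 3) => a b ab.
move: h2; rewrite sqrrD; lra.
Qed.

Lemma clamp_itv x w : 0 <= x -> 0 <= clamp x w <= x.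
Proof.
move=> x0; rewrite /clamp le_max lexx /= ge_max x0 ge_min lexx orbT//.
Qed.

Lemma clamp_le0 x w : w <= 0 -> clamp x w = 0.
Proof. by move=> w0; rewrite /clamp max_l// ge_min w0. Qed.

Lemma clamp_id x w : 0 <= w <= x -> clamp x w = w.
Proof. by move=> /andP[w0 wx]; rewrite /clamp min_l// max_r. Qed.

Lemma clamp_ge x w : 0 <= x <= w -> clamp x w = x.
Proof. by move=> /andP[x0 xw]; rewrite /clamp min_r// max_r. Qed.

Lemma clamp_mono x u w : u <= w -> clamp x u <= clamp x w.
Proof.
move=> uw; rewrite /clamp ge_max le_max lexx /= le_max; apply/orP; right.
by rewrite le_min !ge_min uw lexx orbT.
Qed.

(** The test function equals [1] on this half-line, and only its derivative
    close to [0] is felt. *)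
Lemma tilt_pointwise_neg k x e al w D r : 0 <= x -> 0 < e -> 64 * e <= 1 ->
  0 <= k -> 6 * k * x <= 1 -> 0 <= al <= 1 -> w <= 0 ->
  D <= 1 + e * (1 - w) -> r <= e + al * - w ->
  D * tilt_bound k x e w + r - w <= 20 * (1 - w).
Proof.
move=> x0 e0 e64 k0 kx /andP[al0 al1] w0 hD r1.
have G2 : 0 <= tilt_bound k x e w <= 1.
  rewrite /tilt_bound ifT; last lra.
  have cI := clamp_itv (w + e) x0.
  rewrite (tilt'_ge0 k0 kx cI) /=.
  have ce : clamp x (w + e) <= e.
    by rewrite /clamp ge_max (ltW e0) ge_min; apply/orP; left; lra.
  have /andP[c0 cx] := cI.
  have t2 : tilt k (clamp x (w + e)) <= 2 by apply: tilt_le2 => //; lra.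
  apply: (@le_trans _ _ (e * 2)); last lra.
  apply: ler_pM => //; [exact: drift_ge0 cI|by rewrite ltW// tilt_gt0|].
  by have : 0 <= 3 * k * clamp x (w + e) ^+ 2; [rewrite !mulr_ge0// exprn_ge0|lra].
move: G2; move: (tilt_bound k x e w) => G /andP[G0 G1].
have ew0 : 0 <= e * (1 - w) by apply: mulr_ge0; lra.
have ew : e * (1 - w) <= 1 * (1 - w) by rewrite ler_wpM2r; lra.
have : D * G <= (1 + e * (1 - w)) * G by rewrite ler_wpM2r.
have : (1 + e * (1 - w)) * G <= (2 * (1 - w)) * 1 by apply: ler_pM => //; lra.
have : al * - w <= 1 * - w by rewrite ler_wpM2r; lra.
lra.
Qed.

(** The factors [1 + e + e * w] and [1 + (2 * w * e + e ^+ 2)]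
    are both [1 + O(e * (1 + w))]. Their product exceeds [1] by [s], and
    [s * (w + 1)] is still of order [e * (1 + w ^+ 2)]. *)
Lemma mid_polynomial (k w e : R) : 0 <= e -> 64 * e <= 1 -> 0 <= w ->
  w * e <= 8^-1 -> 0 <= k ->
  (1 + e + e * w) * ((w + e - 3 * k * w ^+ 2) * (1 + (2 * w * e + e ^+ 2))) <=
  w - 3 * k * w ^+ 2 + e * (8 + 8 * w ^+ 2).
Proof.
move=> e0 e64 w0 we k0.
have we0 : 0 <= w * e by rewrite mulr_ge0.
have ee : e ^+ 2 <= e by rewrite expr2 ler_piMl; lra.
have ee0 : 0 <= e ^+ 2 by rewrite sqr_ge0.
have kw0 : 0 <= k * w ^+ 2 by rewrite mulr_ge0// sqr_ge0.
pose q := 2 * w * e + e ^+ 2; rewrite -/q.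
have q0 : 0 <= q by rewrite /q; lra.
have q1 : q <= 2^-1 by rewrite /q; lra.
have qe : q <= e * (2 * w + 1) by rewrite /q; lra.
pose s := (1 + e + e * w) * (1 + q) - 1.
have s0 : 0 <= s.
  by rewrite /s; have : 0 <= (e + e * w) * q by [apply: mulr_ge0; lra]; lra.
have s1 : s <= e * (3 + 4 * w).
  rewrite /s; have : (e + e * w) * q <= (e + e * w) * 2^-1 by rewrite ler_wpM2l; lra.
  lra.
have : s * (w + e - 3 * k * w ^+ 2) <= s * (w + 1) by rewrite ler_wpM2l//; lra.
have : s * (w + 1) <= e * (3 + 4 * w) * (w + 1) by rewrite ler_wpM2r//; lra.
have : e * (3 + 4 * w) * (w + 1) <= e * (7 + 8 * w ^+ 2).
  rewrite -mulrA ler_wpM2l//; have := sqr_ge0 (w - 1); lra.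
rewrite (_ : _ * (_ * (1 + q)) = w + e - 3 * k * w ^+ 2 +
  s * (w + e - 3 * k * w ^+ 2)); last by rewrite /s; ring.
lra.
Qed.

(** The drift [- 3 * k * w ^+ 2] dominates the error
    [9 * e * (1 + w ^+ 2)] because [18 * e <= k], and at least
    half of [k * w ^+ 2] is left over. *)
Lemma tilt_pointwise_mid k x e w D r c : 0 < e -> 64 * e <= 1 -> x * e <= 8^-1 ->
  0 < k -> 18 * e <= k -> 6 * k * x <= 1 -> 0 <= c <= 2^-1 ->
  0 < w <= x -> D <= 1 + e * (1 + w) -> r <= e * (1 + w ^+ 2) ->
  D * tilt_bound k x e w + r * tilt k w - w * tilt k w <=
  20 - c * k * (w * w * tilt k w).
Proof.
move=> e0 e64 xe k0 ek kx /andP[c0 c1] /andP[w0 wx] hD r2.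
have k0' := ltW k0; have w0' := ltW w0; have e0' := ltW e0.
have x0 : 0 <= x by exact: le_trans wx.
have T0 := tilt_gt0 k w.
have we : w * e <= 8^-1 by rewrite (le_trans _ xe)// ler_wpM2r.
have we0 : 0 <= w * e by rewrite mulr_ge0.
have DG : D * tilt_bound k x e w <=
    (w - 3 * k * w ^+ 2 + e * (8 + 8 * w ^+ 2)) * tilt k w.
  rewrite /tilt_bound ifT; last lra.
  set u := clamp x (w + e).
  have /andP[u0 ux] : 0 <= u <= x by exact: clamp_itv.
  have wu : w <= u.
    by rewrite /u -{1}(clamp_id (x := x) (w := w)) ?w0'// clamp_mono// lerDl.
  have ue : u <= w + e by rewrite /u /clamp ge_max ge_min lexx /= andbT; lra.
  have g : tilt k u <= tilt k w * (1 + (2 * w * e + e ^+ 2)).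
    apply: tilt_growth => //; first by rewrite w0'.
    have : e * e <= 64^-1 * 1 by apply: ler_pM => //; lra.
    by rewrite expr2; lra.
  have p0 : 0 <= u - 3 * k * u ^+ 2 by apply: (drift_ge0 k0' kx); rewrite u0.
  have pa : u - 3 * k * u ^+ 2 <= w + e - 3 * k * w ^+ 2.
    have : k * w ^+ 2 <= k * u ^+ 2 by rewrite ler_pM2l// lerXn2r// nnegrE.
    lra.
  apply: (@le_trans _ _ ((1 + e + e * w) * tilt' k u)).
    by rewrite ler_wpM2r ?(tilt'_ge0 k0' kx) ?u0//; lra.
  apply: (@le_trans _ _ ((1 + e + e * w) * ((w + e - 3 * k * w ^+ 2) *
      (tilt k w * (1 + (2 * w * e + e ^+ 2)))))).
    apply: ler_wpM2l; first lra.
    by rewrite /tilt' ler_pM ?(ltW (tilt_gt0 _ _)).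
  rewrite (_ : _ * (_ * (_ * _)) = (1 + e + e * w) * ((w + e - 3 * k * w ^+ 2) *
      (1 + (2 * w * e + e ^+ 2))) * tilt k w); last by ring.
  by rewrite ler_pM2r// mid_polynomial.
have rT : r * tilt k w <= e * (1 + w ^+ 2) * tilt k w by rewrite ler_pM2r.
have kT0 : 0 <= k * w ^+ 2 * tilt k w by rewrite !mulr_ge0// ltW.
have cT : c * k * (w * w * tilt k w) <= 2^-1 * (k * w ^+ 2 * tilt k w).
  rewrite (_ : c * k * _ = c * (k * w ^+ 2 * tilt k w)); last by ring.
  by rewrite ler_wpM2r.
have eT : 9 * e * w ^+ 2 * tilt k w <= 2^-1 * (k * w ^+ 2 * tilt k w).
  have : 18 * e * w ^+ 2 * tilt k w <= k * w ^+ 2 * tilt k w.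
    by rewrite ler_pM2r// ler_wpM2r// sqr_ge0.
  lra.
have eT1 : 9 * e * tilt k w <= 2 + k * w ^+ 2 * tilt k w.
  have ek9 : 0 <= 9 * e <= k by clear -ek e0; apply/andP; split; lra.
  by apply: tilt_absorb ek9 _ w0'; clear -e64; lra.
move: (tilt k w) (D * tilt_bound k x e w) DG rT kT0 cT eT eT1 => F X; clear.
move=> *; lra.
Qed.

Lemma gap_polynomial (k x e : R) : 0 <= e -> 64 * e <= 1 -> x * e <= 8^-1 ->
  0 <= x -> 18 * e <= k ->
  e * (1 + x + e) * x + e * (1 + (x + e) ^+ 2) <= 9 * e + 2^-1 * (k * x ^+ 2).
Proof.
move=> e0 e64 xe x0 ek.
have ee : e ^+ 2 <= e by rewrite expr2 ler_piMl; lra.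
have xe0 : 0 <= x * e by rewrite mulr_ge0.
apply: (@le_trans _ _ (e * (9 + 9 * x ^+ 2))).
  rewrite -mulrA -mulrDr ler_wpM2l//; have := sqr_ge0 (x - 1); lra.
by have : 18 * e * x ^+ 2 <= k * x ^+ 2; [rewrite ler_wpM2r// sqr_ge0|lra].
Qed.

(** Past [x] the test function is constant, but [w + t] may still lie below
    [x], so that the derivative has to be taken into account up to [x + e]. *)
Lemma tilt_pointwise_gap k x e w D r c : 0 <= x -> 0 < e -> 64 * e <= 1 -> x * e <= 8^-1 ->
  0 < k <= 1 -> 18 * e <= k -> 6 * k * x <= 1 -> 0 <= c <= 2^-1 ->
  x < w <= x + e -> D <= 1 + e * (1 + w) -> r <= e * (1 + w ^+ 2) ->
  D * tilt_bound k x e w + r * tilt k x - w * tilt k x <=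
  20 - c * k * (w * x * tilt k x).
Proof.
move=> x0 e0 e64 xe /andP[k0 k1] ek kx /andP[c0 c1] /andP[xw we] hD r2.
have k0' := ltW k0; have e0' := ltW e0.
have w0 : 0 < w by exact: le_lt_trans xw.
have T0 := tilt_gt0 k x; have T0' := ltW T0.
have xe0 : 0 <= x * e by rewrite mulr_ge0.
have kxx : 0 <= k * x ^+ 2 by rewrite mulr_ge0// sqr_ge0.
have DG : D * tilt_bound k x e w <=
    (x - 3 * k * x ^+ 2 + e * (1 + x + e) * x) * tilt k x.
  rewrite /tilt_bound ifT// clamp_ge; last by rewrite x0; lra.
  have p0 : 0 <= x - 3 * k * x ^+ 2 by apply: (drift_ge0 k0' kx); rewrite x0 lexx.
  rewrite /tilt' mulrA ler_pM2r//.
  apply: (@le_trans _ _ ((1 + e * (1 + x + e)) * (x - 3 * k * x ^+ 2))).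
    rewrite ler_wpM2r//; have : e * w <= e * (x + e) by rewrite ler_pM2l//.
    clear -hD; lra.
  rewrite mulrDl mul1r lerD2l ler_wpM2l//; last by clear -kxx; lra.
  by rewrite mulr_ge0 ?addr_ge0.
have rT : r * tilt k x <= e * (1 + (x + e) ^+ 2) * tilt k x.
  by rewrite ler_pM2r// (le_trans r2)// ler_pM2l// lerD2l lerXn2r ?nnegrE ?addr_ge0// ltW.
have wT : x * tilt k x <= w * tilt k x by rewrite ler_pM2r// ltW.
have pT : (e * (1 + x + e) * x + e * (1 + (x + e) ^+ 2)) * tilt k x <=
    (9 * e + 2^-1 * (k * x ^+ 2)) * tilt k x.
  by rewrite ler_pM2r// gap_polynomial.
have cT : c * k * (w * x * tilt k x) <= (2^-1 * (k * x ^+ 2 + k * x * e)) * tilt k x.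
  rewrite (_ : c * k * (w * x * _) = c * (k * x * w) * tilt k x); last by ring.
  rewrite ler_pM2r//.
  have h : k * x * w <= k * x * (x + e) by rewrite ler_wpM2l// mulr_ge0.
  have h0 : 0 <= k * x * w by rewrite !mulr_ge0// ltW.
  have : c * (k * x * w) <= 2^-1 * (k * x * w) by rewrite ler_wpM2r.
  lra.
have kxe : k * x * e <= k * 8^-1 by rewrite -mulrA ler_pM2l.
have eT1 : (9 * e + k * x * e) * tilt k x <= 2 + k * x ^+ 2 * tilt k x.
  have kxe0 : 0 <= k * x * e by rewrite !mulr_ge0.
  have h : 9 * e + k * x * e <= k by clear -ek kxe k0'; lra.
  by apply: tilt_absorb => //; [rewrite h addr_ge0 ?mulr_ge0|exact: le_trans h k1].
have kT0 : 0 <= k * x ^+ 2 * tilt k x by rewrite mulr_ge0.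
have kT1 : 0 <= k * x * e * tilt k x by rewrite !mulr_ge0.
move: (tilt k x) (D * tilt_bound k x e w) DG rT wT pT cT eT1 kT0 kT1 => F X; clear.
move=> *; lra.
Qed.

(** The derivative is out of reach here, and the drift [- w] prevails over
    [r] by a margin [(1 - al) * w], part of which is [k * w * x]
    because [6 * k * x <= 1]. *)
Lemma tilt_pointwise_tail k x e al w D r : 0 <= x -> 0 < e -> 64 * e <= 1 ->
  0 < k -> 6 * k * x <= 1 -> 0 <= al < 1 -> 8 * e <= 1 - al ->
  x + e < w -> r <= e + al * w ->
  D * tilt_bound k x e w + r * tilt k x - w * tilt k x <=
  20 - (1 - al) / 2 * k * (w * x * tilt k x).
Proof.
move=> x0 e0 e64 k0 kx /andP[al0 al1] eal xw r1.
have w0 : 0 < w by lra.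
have T0 := tilt_gt0 k x; have T0' := ltW T0.
rewrite /tilt_bound ifF; last by apply/negbTE; rewrite -ltNge.
rewrite mulr0 add0r.
have cT : (1 - al) / 2 * k * (w * x * tilt k x) <= (1 - al) / 12 * w * tilt k x.
  rewrite (_ : _ * (w * x * _) = (1 - al) / 12 * (6 * k * x * w) * tilt k x); last by field.
  rewrite ler_pM2r//; apply: ler_wpM2l; first lra.
  by rewrite ler_piMl// ltW.
have rT : r * tilt k x <= (e + al * w) * tilt k x by rewrite ler_pM2r.
have alw : 0 <= (1 - al) * w by rewrite mulr_ge0 ?subr_ge0// ltW.
have : (e - (1 - al) * w + (1 - al) / 12 * w) * tilt k x <= 20.
  have [x1|x1] := leP x 1.
    have t2 : tilt k x <= 2 by apply: tilt_le2; [exact: ltW|rewrite x0].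
    apply: (@le_trans _ _ (1 * tilt k x)); first by rewrite ler_pM2r//; lra.
    lra.
  apply: (@le_trans _ _ 0) => //; rewrite pmulr_lle0//.
  have : 1 - al <= (1 - al) * w by rewrite ler_peMr//; lra.
  lra.
move: (tilt k x) cT rT => F; clear => *; lra.
Qed.

(** The fraction [(1 - al) / 2] is what the region [x + e < w] allows;
    the other regions allow one half. *)
Lemma tilt_pointwise k x e al w D r : 0 <= x -> 0 < e -> 64 * e <= 1 -> x * e <= 8^-1 ->
  0 < k <= 1 -> 18 * e <= k -> 6 * k * x <= 1 -> 0 <= al < 1 -> 8 * e <= 1 - al ->
  `|D - 1| <= e * (1 + `|w|) -> `|r| <= e * (1 + w ^+ 2) -> `|r| <= e + al * `|w| ->
  D * tilt_bound k x e w + r * tilt k (clamp x w) - w * tilt k (clamp x w) <=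
  20 * (1 + `|w|) - (1 - al) / 2 * k * (Num.max 0 w * clamp x w * tilt k (clamp x w)).
Proof.
move=> x0 e0 e64 xe k01 ek kx al01 eal; rewrite ler_norml => /andP[_ hD] hr2 hr1.
have /andP[k0 k1] := k01; have /andP[al0 al1] := al01.
have hD' : D <= 1 + e * (1 + `|w|) by lra.
have r2 : r <= e * (1 + w ^+ 2) by rewrite (le_trans (ler_norm _)).
have r1 : r <= e + al * `|w| by rewrite (le_trans (ler_norm _)).
have c01 : 0 <= (1 - al) / 2 <= 2^-1 by apply/andP; split; lra.
clear hD hr1 hr2.
have [w0|w0] := leP w 0.
  rewrite (clamp_le0 _ w0) !mul0r mulr0 subr0.
  have -> : tilt k 0 = 1 by rewrite /tilt !expr0n /= mul0r mulr0 subr0 expR0.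
  move: hD' r1; rewrite !mulr1 ler0_norm// => hD' r1.
  by apply: tilt_pointwise_neg hD' r1 => //; rewrite ?(ltW k0)// al0 ltW.
have w0' := ltW w0; move: hD' r1; rewrite ger0_norm// => hD' r1.
apply: (@le_trans _ _ (20 - (1 - al) / 2 * k * (w * clamp x w * tilt k (clamp x w)))).
  have [wx|xw] := leP w x.
    rewrite clamp_id ?w0'//; apply: tilt_pointwise_mid => //.
    by rewrite w0.
  rewrite clamp_ge ?x0 ?(ltW xw)//; have [we|we] := leP w (x + e).
    by apply: tilt_pointwise_gap => //; rewrite xw.
  exact: tilt_pointwise_tail.
by rewrite lerD2r ler_peMr// lerDl.
Qed.

End weighted_exponential.

Lemma clamp_continuous {R : realType} (x : R) : continuous (clamp x).
Proof.
move=> w; have cmin : {for w, continuous (fun u => Num.min u x)}.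
  by apply: continuous_min; [exact: cvg_id|exact: cvg_cst].
exact: (@continuous_max _ _ (cst 0) _ w (cvg_cst _) cmin).
Qed.

(** * An exponential moment of the clamped variable *)

Section tilt_parameter.
Context {R : realType}.
Implicit Types x e : R.

(** The choice behind the estimates of [tilt_rateP]: [18 * e] is at most the
    rate since
    [e * (20 + x) ^+ 3 <= 4 * (20 ^+ 3 * e + x ^+ 3 * e) <= 20];
    and [2700 * x <= (20 + x) ^+ 3], with equality at [x = 10]. *)
Definition tilt_rate x : R := 18 * 20 / (20 + x) ^+ 3.

Lemma tilt_rateP x e : 0 <= x -> 0 < e -> 64 * e <= 1 -> 20 ^+ 3 * e <= 1 ->
  x ^+ 3 * e <= 4 ->
  [/\ x * e <= 8^-1, 0 < tilt_rate x <= 1, 18 * e <= tilt_rate x,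
      6 * tilt_rate x * x <= 1 & tilt_rate x * x ^+ 3 <= 18 * 20].
Proof.
move=> x0 e0 e64 e20 x3e.
have N0 : 0 < (20 + x) ^+ 3 by rewrite exprn_gt0// ltr_wpDr.
have NE : tilt_rate x * (20 + x) ^+ 3 = 18 * 20.
  by rewrite /tilt_rate; apply: divfK; exact: lt0r_neq0.
have N360 : 18 * 20 <= (20 + x) ^+ 3.
  apply: (@le_trans _ _ (20 ^+ 3)); first by rewrite -natrX -natrM ler_nat.
  by apply: lerXn2r; rewrite ?nnegrE ?lerDl//; exact: addr_ge0.
have Nx : 27 * 100 * x <= (20 + x) ^+ 3.
  rewrite -subr_ge0 (_ : _ - _ = (x - 10) ^+ 2 * (x + 80)); last by ring.
  by apply: mulr_ge0; [exact: sqr_ge0|exact: addr_ge0].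
have Ne : e * (20 + x) ^+ 3 <= 20.
  have : (20 + x) ^+ 3 <= 4 * (20 ^+ 3 + x ^+ 3).
    rewrite -subr_ge0 (_ : _ - _ = 3 * (20 + x) * (20 - x) ^+ 2); last by ring.
    by apply: mulr_ge0; [apply: mulr_ge0 => //; exact: addr_ge0|exact: sqr_ge0].
  move=> h; have : e * (20 + x) ^+ 3 <= e * (4 * (20 ^+ 3 + x ^+ 3)) by rewrite ler_pM2l.
  by move: ((20 + x) ^+ 3) (20 ^+ 3) (x ^+ 3) e20 x3e => N a b; lra.
have x3N : x ^+ 3 <= (20 + x) ^+ 3.
  by apply: lerXn2r; rewrite ?nnegrE ?lerDr//; exact: addr_ge0.
have c2 : 6 * (18 * 20) <= 27 * 100 :> R by rewrite -!natrM ler_nat.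
move: (tilt_rate x) NE => t; move: ((20 + x) ^+ 3) N0 N360 Nx Ne x3N => N N0 N360 Nx Ne x3N NE.
have t0 : 0 < t by rewrite -(pmulr_lgt0 _ N0) NE mulr_gt0.
split.
- rewrite -(@ler_pXn2r _ 3)// ?nnegrE ?mulr_ge0 ?(ltW e0)//.
  rewrite exprMn [e ^+ 3]exprS mulrA.
  have e2 : e ^+ 2 <= 64^-1 ^+ 2 by rewrite lerXn2r ?nnegrE ?(ltW e0)//; lra.
  apply: (@le_trans _ _ (4 * 64^-1 ^+ 2)).
    by apply: ler_pM => //; rewrite ?mulr_ge0 ?exprn_ge0 ?(ltW e0).
  lra.
- by rewrite t0 -(ler_pM2r N0) mul1r NE.
- by rewrite -(ler_pM2r N0) NE -mulrA ler_pM2l.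
- rewrite -(ler_pM2r N0) mul1r (_ : 6 * t * x * N = 6 * (t * N) * x); last by ring.
  by rewrite NE (le_trans _ Nx)// ler_wpM2r.
- by rewrite -NE ler_pM2l.
Qed.

Lemma tilt_rate_inv x : 0 <= x -> (tilt_rate x)^-1 <= 20 ^+ 3 * (1 + x ^+ 3).
Proof.
move=> x0; rewrite /tilt_rate invf_div.
have c0 : 0 < 18 * 20 :> R by exact: mulr_gt0.
rewrite ler_pdivrMr//.
have : (20 + x) ^+ 3 <= 4 * (20 ^+ 3 + x ^+ 3).
  rewrite -subr_ge0 (_ : _ - _ = 3 * (20 + x) * (20 - x) ^+ 2); last by ring.
  by apply: mulr_ge0; [apply: mulr_ge0 => //; exact: addr_ge0|exact: sqr_ge0].
have : 1 <= 20 ^+ 3 :> R by rewrite exprn_ege1// ler1n.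
have : 0 <= x ^+ 3 by rewrite exprn_ge0.
move: ((20 + x) ^+ 3) (20 ^+ 3) (x ^+ 3) => N a b b0 a1.
have : 0 <= (a - 1) * b by rewrite mulr_ge0// subr_ge0.
lra.
Qed.

End tilt_parameter.

Lemma moment_arithmetic {R : realType} (b k y E A I a : R) :
  0 < b -> 0 < k -> 0 <= y -> 0 < E -> 0 <= A -> k^-1 <= a * (1 + y) ->
  A <= 1 + 6 / b -> b / 2 * k * I <= 20 * (1 + A) ->
  4 * (1 + A) + 4 * E * I <= (2 + 6 / b) * (4 + 160 * a * E / b) * (1 + y).
Proof.
move=> b0 k0 y0 E0 A0 ka Ab kI.
have ik0 : 0 < k^-1 by rewrite invr_gt0.
have a0 : 0 <= a.
  by have : 0 <= a * (1 + y) by [exact: le_trans (ltW ik0) ka]; rewrite pmulr_lge0//; lra.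
have I1 : I <= 40 / b * k^-1 * (1 + A).
  rewrite (_ : 40 / _ * _ * _ = (20 * (1 + A)) / (b / 2 * k)); last first.
    by field; rewrite !lt0r_neq0.
  by rewrite ler_pdivlMr ?mulr_gt0 ?invr_gt0// mulrC.
have A1 : 0 <= 1 + A by exact: addr_ge0.
have y1 : 0 <= 1 + y by exact: addr_ge0.
have I2 : I <= 40 / b * (a * (1 + y)) * (1 + A).
  apply: (le_trans I1); apply: ler_wpM2r => //; apply: ler_wpM2l => //.
  by rewrite divr_ge0// ltW.
apply: (@le_trans _ _ ((1 + A) * (4 + 160 * a * E / b) * (1 + y))); last first.
  apply: ler_wpM2r => //; apply: ler_wpM2r; last by clear -Ab; lra.
  apply: addr_ge0; first exact: ler0n.
  apply: divr_ge0 (ltW b0); apply: mulr_ge0 (ltW E0).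
  exact: mulr_ge0 (ler0n _ 160) a0.
have h1 : 4 * E * I <= 4 * E * (40 / b * (a * (1 + y)) * (1 + A)).
  by rewrite ler_wpM2l// mulr_ge0// ltW.
have h2 : 0 <= (1 + A) * y by rewrite mulr_ge0.
rewrite (_ : (1 + A) * _ * _ = 4 * (1 + A) + 4 * ((1 + A) * y) +
  4 * E * (40 / b * (a * (1 + y)) * (1 + A))); last first.
  by field; rewrite lt0r_neq0.
by clear -h1 h2; lra.
Qed.

Section weighted_exponential_moment.
Context {d} {T : measurableType d} {R : realType}.
Variables (P : probability T R) (W Rem : {RV P >-> R}) (mu : R.-sfker T ~> R).
Variables (delta : R) (EDW ERW : T -> R) (e al : R).
Hypothesis small : small_remainders W Rem mu delta EDW ERW e al.

(** Up to a constant multiple of [e * (1 - Phi y)], the size of the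
    errors when the Stein solution is the test function. *)
Definition moment_weight (x w : R) : R :=
  (1 + `|w|) * (1 + clamp x w) * expR (clamp x w ^+ 2 / 2).

Definition moment_const : R :=
  (2 + 6 / (1 - al)) * (4 + 160 * 20 ^+ 3 * expR (18 * 20) / (1 - al)).

Let S (k x w : R) : R := Num.max 0 w * (clamp x w * tilt k (clamp x w)).

Lemma integrable_tilted (k x : R) : 0 <= x -> 0 <= k -> 6 * k * x <= 1 ->
  P.-integrable [set: T] (fun w => (S k x (W w))%:E).
Proof.
move=> x0 k0 kx.
have iW := integrable_W small.
have mc : measurable_fun [set: T] (fun w => clamp x (W w)).
  have mcl : measurable_fun [set: R] (clamp x).
    by apply: continuous_measurable_fun; exact: clamp_continuous.
  exact: measurableT_comp mcl _.
have mt : measurable_fun [set: R] (tilt k).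
  by apply: continuous_measurable_fun; exact: (is_derive_continuous (is_derive_tilt k)).
apply: (@integrableM_bounded _ _ _ P (fun w => Num.max 0 (W w))
   (fun w => clamp x (W w) * tilt k (clamp x (W w))) (x * tilt k x)).
- apply: (le_integrable measurableT _ _ iW).
    by apply/measurable_EFinP; exact: measurable_maxr.
  move=> w _; rewrite lee_fin /=; case: (leP 0 (W w)) => // w0.
  by rewrite normr0.
- by apply: measurable_funM => //; exact: measurableT_comp.
- move=> w; have /andP[c0 cx] := clamp_itv (W w) x0.
  rewrite ger0_norm; last by rewrite mulr_ge0// ltW// tilt_gt0.
  apply: ler_pM => //; first by rewrite ltW// tilt_gt0.
  exact: (tilt_incr k0 kx).
Qed.

Lemma integrable_1Dabs : P.-integrable [set: T] (EFin \o (fun w => 1 + `|W w|)).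
Proof.
have i1 : P.-integrable [set: T] (EFin \o cst 1).
  exact: (@integrable_bounded _ _ _ P (cst 1) `|1|).
have := integrableD measurableT i1 (integrable_norm (integrable_W small)).
by apply: eq_integrable.
Qed.

Lemma mean_1Dabs : \int[P]_w (1 + `|W w|) = 1 + \int[P]_w `|W w|.
Proof.
rewrite RintegralD// ?Rintegral_cst1//.
  exact: (@integrable_bounded _ _ _ P (cst 1) `|1|).
exact: integrable_norm (integrable_W small).
Qed.

(** The test function [tilt k \o clamp x] is continuous, and smooth except
    at [0] and [x]. *)
Lemma tilted_moment (x : R) : 0 <= x -> x ^+ 3 * e <= 4 ->
  (1 - al) / 2 * tilt_rate x * \int[P]_w S (tilt_rate x) x (W w) <=
  20 * (1 + \int[P]_w `|W w|).
Proof.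
move=> x0 x3e; have e0 := sr_e_gt0 small; have e64 := sr_e64 small.
have [xe k01 ek kx _] := tilt_rateP x0 e0 e64 (sr_e small) x3e.
move: (tilt_rate x) k01 ek kx => k k01 ek kx; have /andP[k0 k1] := k01.
have k0' := ltW k0.
pose f := tilt k \o clamp x.
pose f' (w : R) := if 0 < w < x then tilt' k w else 0.
have mt : measurable_fun [set: R] (tilt k).
  by apply: continuous_measurable_fun; exact: (is_derive_continuous (is_derive_tilt k)).
have ct' : continuous (tilt' k).
  move=> u; apply: cvgM; last exact: (is_derive_continuous (is_derive_tilt k)).
  apply: (@is_derive_continuous _ (fun u => u - 3 * k * u ^+ 2)
    (fun u => 1 - (3 * k) * (2 * u))) => {}u.
  exact: is_derive_add (is_derive_idR u) (is_derive_neg (is_derive_scale _ (is_derive_sqr u))).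
have mt' : measurable_fun [set: R] (tilt' k) by exact: continuous_measurable_fun.
have cc := clamp_continuous (x := x).
have mc : measurable_fun [set: R] (clamp x) by exact: continuous_measurable_fun.
have mid : measurable_fun [set: R] (fun w : R => w) by exact: measurable_id.
have cf : continuous f.
  move=> w; apply: continuous_comp; first exact: cc.
  exact: (is_derive_continuous (is_derive_tilt k)).
have df (z : R) : z \notin [:: 0; x] -> is_derive z 1 f (f' z).
  rewrite !inE negb_or => /andP[z0 zx]; rewrite /f'.
  have [zl|zg] := ltP z 0.
    rewrite ifF; last by rewrite ltNge (ltW zl).
    apply: (near_eq_is_derive _ (is_derive_cst (tilt k 0) z 1)).
    have : \forall y \near z, y < 0 by exact: lt_nbhsl.
    by apply: filterS => y y0; rewrite /f /= clamp_le0// ltW.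
  have {z0}zg : 0 < z by rewrite lt_neqAle eq_sym z0.
  have [zl|xz] := ltP z x.
    rewrite zg /=; apply: (near_eq_is_derive _ (is_derive_tilt k z)).
    have h1 : \forall y \near z, y < x by exact: lt_nbhsl.
    have h2 : \forall y \near z, 0 < y by exact: lt_nbhsr.
    by apply: filterS2 h1 h2 => y y1 y2; rewrite /f /= clamp_id// !ltW.
  rewrite andbF; apply: (near_eq_is_derive _ (is_derive_cst (tilt k x) z 1)).
  have : \forall y \near z, x < y by apply: lt_nbhsr; rewrite lt_neqAle eq_sym zx.
  by apply: filterS => y y0; rewrite /f /= clamp_ge// x0 ltW.
have mf' : measurable_fun [set: R] f'.
  apply: measurable_fun_ifT => //.
  by apply: measurable_and; exact: measurable_fun_ltr.
have mG : measurable_fun [set: R] (tilt_bound k x e).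
  apply: measurable_fun_ifT => //; first exact: measurable_fun_ler.
  apply: measurableT_comp => //; apply: measurableT_comp => //.
  exact: measurable_funD.
pose B := (1 + x) * tilt k x.
have T0 := ltW (tilt_gt0 k x).
have tB (u : R) : 0 <= u <= x -> 0 <= tilt' k u <= B.
  move=> ux; rewrite (tilt'_ge0 k0' kx)//=; have /andP[u0 u1] := ux.
  rewrite (le_trans (tilt'_incr k0' kx u0 u1 (lexx x)))// /tilt' /B ler_wpM2r//.
  by have : 0 <= 3 * k * x ^+ 2; [rewrite !mulr_ge0// sqr_ge0|lra].
have B0 : 0 <= B by rewrite mulr_ge0//; lra.
have fB (z : R) : `|f z| <= B.
  rewrite ger0_norm /f /=; last exact: ltW (tilt_gt0 _ _).
  have /andP[c0 c1] := clamp_itv z x0.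
  rewrite (le_trans (tilt_incr k0' kx c0 c1 (lexx x)))// /B ler_peMl//; lra.
have f'B (z : R) : `|f' z| <= B.
  rewrite /f'; case: ifP => [/andP[z0 zx]|_]; last by rewrite normr0.
  by have /andP[h1 h2] := tB z (introT andP (conj (ltW z0) (ltW zx))); rewrite ger0_norm.
have GB (z : R) : `|tilt_bound k x e z| <= B.
  rewrite /tilt_bound; case: ifP => _; last by rewrite normr0.
  by have /andP[h1 h2] := tB _ (clamp_itv (z + e) x0); rewrite ger0_norm.
have iW := integrable_W small.
have mf : measurable_fun [set: T] (fun w => f (W w)).
  apply: (@measurableT_comp _ _ _ _ _ _ f _ W) => //; exact: continuous_measurable_fun.
have iWf := integrableM_bounded iW mf (fun w => fB (W w)).
have f'G (w t : R) : - e <= t <= e -> f' (w + t) <= tilt_bound k x e w.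
  move=> /andP[t1 t2].
  have Gp : 0 <= tilt_bound k x e w.
    rewrite /tilt_bound; case: ifP => // _.
    by have /andP[] := tB _ (clamp_itv (w + e) x0).
  rewrite /f'; case: ifP => // /andP[u0 ux].
  rewrite /tilt_bound ifT; last lra.
  have /andP[c0 c1] := clamp_itv (w + e) x0.
  apply: (tilt'_incr k0' kx (ltW u0) _ c1).
  rewrite -{1}(clamp_id (x := x) (w := w + t)) ?(ltW u0) ?(ltW ux)//.
  by apply: clamp_mono; rewrite lerD2l.
have iS := integrable_tilted x0 k0' kx.
pose h w := 20 * (1 + `|w|) - (1 - al) / 2 * k * S k x w.
have iA20 : P.-integrable [set: T] (EFin \o (fun w => 20 * (1 + `|W w|))).
  have := integrableZl measurableT 20 integrable_1Dabs.
  by apply: eq_integrable => // w _; rewrite /= EFinM.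
have ikS : P.-integrable [set: T] (EFin \o (fun w => (1 - al) / 2 * k * S k x (W w))).
  have := integrableZl measurableT ((1 - al) / 2 * k) iS.
  by apply: eq_integrable => // w _; rewrite /= EFinM.
have ih : P.-integrable [set: T] (fun w => (h (W w))%:E).
  have := integrableB measurableT iA20 ikS.
  by apply: eq_integrable => // w _; rewrite /= EFinB.
have := stein_pointwise small cf df mf' mG fB f'B GB iWf f'G ih.
have -> : \int[P]_w h (W w) = 20 * (1 + \int[P]_w `|W w|) -
    (1 - al) / 2 * k * \int[P]_w S k x (W w).
  by rewrite RintegralB// !RintegralZl ?mean_1Dabs//; exact: integrable_1Dabs.
rewrite subr_ge0; apply => w D r hD r2 r1.
rewrite /h /S (mulrA (Num.max 0 w)).
exact: (tilt_pointwise x0 e0 e64 xe k01 ek kx (sr_al small) (sr_e_al small) hD r2 r1).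
Qed.

(** Where [clamp x w <= 1], only [1 + `|w|] matters. Elsewhere
    [k * clamp x w ^+ 3] is at most [360], so that dropping the cubic
    term costs a constant factor. *)
Lemma moment_weight_le (k x w : R) : 0 <= x -> k * x ^+ 3 <= 18 * 20 -> 0 <= k ->
  moment_weight x w <= 4 * (1 + `|w|) + 4 * expR (18 * 20) * S k x w.
Proof.
move=> x0 kx k0; rewrite /moment_weight /S.
have /andP[c0 c1] := clamp_itv w x0.
have S0 : 0 <= Num.max 0 w * (clamp x w * tilt k (clamp x w)).
  by rewrite !mulr_ge0 ?le_max ?lexx// ltW// tilt_gt0.
have a0 : 0 <= `|w| by [].
have E0 := expR_gt0 (clamp x w ^+ 2 / 2).
have [v1|v1] := leP (clamp x w) 1.
  have E2 : expR (clamp x w ^+ 2 / 2) <= 2.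
    have := @tilt_le2 R 0 (clamp x w) (lexx 0); rewrite c0 v1 => /(_ isT).
    by rewrite /tilt mul0r subr0.
  have : (1 + `|w|) * (1 + clamp x w) * expR (clamp x w ^+ 2 / 2) <=
      (1 + `|w|) * 2 * 2.
    apply: ler_pM => //; first by rewrite mulr_ge0//; lra.
    by apply: ler_wpM2l; lra.
  have : 0 <= 4 * expR (18 * 20) * (Num.max 0 w * (clamp x w * tilt k (clamp x w))).
    by rewrite mulr_ge0// mulr_ge0// ltW// expR_gt0.
  lra.
have w1 : 1 < w.
  by move: v1; rewrite /clamp lt_max ltNge ler01 /= lt_min => /andP[].
have w0 : 0 <= w by lra.
rewrite max_r// ger0_norm//.
have Ft : expR (clamp x w ^+ 2 / 2) <= expR (18 * 20) * tilt k (clamp x w).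
  rewrite /tilt -expRD ler_expR.
  have : k * clamp x w ^+ 3 <= k * x ^+ 3.
    by rewrite ler_wpM2l// lerXn2r ?nnegrE.
  move=> h; have := le_trans h kx; move=> h'; lra.
have h1 : (1 + w) * (1 + clamp x w) <= 4 * (w * clamp x w).
  have : 0 <= (w - 1) * (clamp x w - 1) by apply: mulr_ge0; lra.
  lra.
have h2 : (1 + w) * (1 + clamp x w) * expR (clamp x w ^+ 2 / 2) <=
   4 * (w * clamp x w) * (expR (18 * 20) * tilt k (clamp x w)).
  by apply: ler_pM => //; rewrite mulr_ge0//; lra.
apply: (le_trans h2).
rewrite (_ : 4 * (w * _) * _ = 4 * expR (18 * 20) * (w * (clamp x w * tilt k (clamp x w)))); last by ring.
by rewrite lerDr mulr_ge0//; lra.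
Qed.

Lemma integrable_moment_weight (x : R) : 0 <= x ->
  P.-integrable [set: T] (fun w => (moment_weight x (W w))%:E).
Proof.
move=> x0.
have mcl : measurable_fun [set: R] (clamp x).
  by apply: continuous_measurable_fun; exact: clamp_continuous.
have mc : measurable_fun [set: T] (fun w => clamp x (W w)) by exact: measurableT_comp mcl _.
have := @integrableM_bounded _ _ _ P (fun w => 1 + `|W w|)
  (fun w => (1 + clamp x (W w)) * expR (clamp x (W w) ^+ 2 / 2))
  ((1 + x) * expR (x ^+ 2 / 2)) integrable_1Dabs.
rewrite (_ : (fun w => _) = (fun w => (moment_weight x (W w))%:E)); last first.
  by apply/funext => w; rewrite /moment_weight mulrA.
apply.
  apply: measurable_funM; first exact: measurable_funD.
  apply: measurableT_comp => //; apply: measurable_funM => //.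
  exact: measurable_funX.
move=> w; have /andP[c0 c1] := clamp_itv (W w) x0.
rewrite ger0_norm; last by rewrite mulr_ge0//; lra.
apply: ler_pM => //; [lra|lra|].
by rewrite ler_expR ler_wpM2r// lerXn2r ?nnegrE.
Qed.

(** The factor [1 + x ^+ 3] is the price of dividing [tilted_moment] by
    the rate ([tilt_rate_inv]). *)
Lemma mean_moment_weight_le (x : R) : 0 <= x -> x ^+ 3 * e <= 4 ->
  \int[P]_w moment_weight x (W w) <= moment_const * (1 + x ^+ 3).
Proof.
move=> x0 x3e; have e0 := sr_e_gt0 small; have e64 := sr_e64 small.
have [_ k01 _ kx kx3] := tilt_rateP x0 e0 e64 (sr_e small) x3e.
have k3 := tilt_rate_inv x0.
have tm := tilted_moment x0 x3e.
move: (tilt_rate x) k01 kx kx3 k3 tm => k /andP[k0 k1] kx kx3 k3 tm.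
have k0' := ltW k0.
have iS := integrable_tilted x0 k0' kx.
have /andP[al0 al1] := sr_al small.
have al1' : 0 < 1 - al by rewrite subr_gt0.
have iA4 : P.-integrable [set: T] (EFin \o (fun w => 4 * (1 + `|W w|))).
  have := integrableZl measurableT 4 integrable_1Dabs.
  by apply: eq_integrable => // w _; rewrite /= EFinM.
have iS4 : P.-integrable [set: T] (EFin \o (fun w => 4 * expR (18 * 20) * S k x (W w))).
  have := integrableZl measurableT (4 * expR (18 * 20)) iS.
  by apply: eq_integrable => // w _; rewrite /= EFinM.
have iSum : P.-integrable [set: T]
   (EFin \o (fun w => 4 * (1 + `|W w|) + 4 * expR (18 * 20) * S k x (W w))).
  have := integrableD measurableT iA4 iS4.
  by apply: eq_integrable.
apply: (@le_trans _ _ (\int[P]_w (4 * (1 + `|W w|) + 4 * expR (18 * 20) * S k x (W w)))).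
  apply: le_Rintegral => //; first exact: integrable_moment_weight.
  by move=> w _; exact: moment_weight_le.
rewrite RintegralD// !RintegralZl//; last exact: integrable_1Dabs.
rewrite mean_1Dabs.
have A0 : 0 <= \int[P]_w `|W w| by apply: Rintegral_ge0 => w _.
by apply: (moment_arithmetic al1' k0 _ _ A0 k3 (mean_abs_le small) tm); rewrite ?exprn_ge0 ?expR_gt0.
Qed.

End weighted_exponential_moment.

(** * Further bounds on the Mills ratio *)

Section mills_bounds.
Context {R : realType}.
Implicit Types x y z w u e : R.
Local Notation Phi := (@std_normal_cdf R).
Local Notation pdf := (normal_pdf (0 : R) 1).
Local Notation m := (@mills_ratio R).

(** The square root of twice pi. *)
Definition gauss_mass : R := (normal_peak (1 : R))^-1.

Lemma gauss_mass_gt0 : 0 < gauss_mass.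
Proof. by rewrite invr_gt0 normal_peak1_gt0. Qed.

Lemma std_normal_pdfV w : (pdf w)^-1 = gauss_mass * expR (w ^+ 2 / 2).
Proof.
rewrite std_normal_pdfE invfM -expRN /gauss_mass; congr (_ * expR _).
by rewrite mulNr opprK mulrC.
Qed.

Lemma mills_decr u w : u <= w -> m w <= m u.
Proof.
move=> uw; rewrite -lerN2.
apply: (@le_of_derive_ge0 _ (fun z => - m z) (fun z => - (z * m z - 1))) => [//|z _|z _].
  exact: is_derive_neg (is_derive_mills z).
by rewrite oppr_ge0 subr_le0 mills_upper.
Qed.

Lemma millsN_le w : m (- w) <= gauss_mass * expR (w ^+ 2 / 2).
Proof. by rewrite -std_normal_pdfV -mills_addN lerDr ltW// mills_gt0. Qed.

Lemma sqr_mills_le u : 0 <= u -> u <= (1 + u ^+ 2) * m u <= u + m u.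
Proof.
move=> u0; apply/andP; split.
  have := mills_lower u; rewrite ler_pdivrMr; first by rewrite mulrC.
  by have := sqr_ge0 u; lra.
have : u * (u * m u) <= u * 1 by rewrite ler_wpM2l// mills_upper.
by rewrite mulrDl mul1r expr2; lra.
Qed.

Lemma mills_inv_le x : 0 <= x -> (m x)^-1 <= 2 * (1 + x).
Proof.
move=> x0; have m0 := mills_gt0 x.
rewrite -ler_pV2 ?inE ?unitfE ?invr_eq0 ?lt0r_neq0 ?invr_gt0//= ?mulr_gt0//; [|lra|lra].
rewrite invrK; have [x1|x1] := leP x 1.
  apply: (@le_trans _ _ (m 1)); last exact: mills_decr.
  apply: (@le_trans _ _ (1 / (1 + 1 ^+ 2))); last exact: mills_lower.
  by rewrite expr1n div1r lef_pV2 ?posrE//; lra.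
apply: le_trans (mills_lower x).
rewrite -[leLHS]div1r ler_pdivrMr ?mulr_gt0//; last lra.
rewrite mulrAC ler_pdivlMr; last by have := sqr_ge0 x; lra.
have : 0 <= (x - 1) * (1 + x) by apply: mulr_ge0; lra.
have := sqr_ge0 (x - 1); lra.
Qed.

Definition mills_const : R := 2 * m (- 1) + 1.

Lemma mills_const_ge1 : 1 <= mills_const.
Proof. by rewrite /mills_const; have := mills_gt0 (- 1 : R); lra. Qed.

Lemma mills_le_const w : - 1 <= w -> m w <= mills_const.
Proof.
by move=> /mills_decr; rewrite /mills_const; have := mills_gt0 (- 1 : R); lra.
Qed.

(** The middle term is the derivative of [w * mills_ratio w]. *)
Lemma mills_slope w : - 1 <= w -> 0 <= (1 + w ^+ 2) * m w - w <= mills_const.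
Proof.
move=> w1; have [w0|w0] := leP 0 w.
  have /andP[h1 h2] := sqr_mills_le w0; have := mills_le_const w1.
  by move=> ?; apply/andP; split; lra.
have m0 := mills_gt0 w; have m1 := mills_decr w1; have w2 := sqr_ge0 w.
have : 0 <= (1 + w ^+ 2) * m w by apply: mulr_ge0; lra.
have : w ^+ 2 <= 1 by have : 0 <= (1 - w) * (1 + w) by [apply: mulr_ge0; lra]; lra.
move=> w3; have : (1 + w ^+ 2) * m w <= 2 * m (- 1).
  by apply: ler_pM => //; [lra|exact: ltW|lra].
by rewrite /mills_const => ? ?; apply/andP; split; lra.
Qed.

Lemma sqr_mills_le_abs w : - 1 <= w -> (1 + w ^+ 2) * m w <= mills_const * (1 + `|w|).
Proof.
move=> w1; have /andP[_ h] := mills_slope w1; have := ler_norm w.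
have : `|w| <= mills_const * `|w| by rewrite ler_peMl// mills_const_ge1.
lra.
Qed.

Lemma std_normal_tailE y : 1 - Phi y = m y * pdf y.
Proof. by rewrite /mills_ratio divfK// lt0r_neq0// std_normal_pdf_gt0. Qed.

Lemma std_normal_tail_gt0 y : 0 < 1 - Phi y.
Proof. by rewrite std_normal_tailE mulr_gt0 ?mills_gt0 ?std_normal_pdf_gt0. Qed.

Lemma std_normal_cdf_gt0 y : 0 < Phi y.
Proof. by have := std_normal_tail_gt0 (- y); rewrite std_normal_cdfN subKr. Qed.

Lemma std_normal_tail_decr x y : x <= y -> 1 - Phi y <= 1 - Phi x.
Proof.
move=> xy; rewrite lerD2l lerN2.
apply: (@le_of_derive_ge0 _ Phi pdf) => // z _; first exact: is_derive_std_normal_cdf.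
exact: ltW (std_normal_pdf_gt0 z).
Qed.

(** The two branches of the Stein solution agree at [y]. *)
Lemma stein_balance y : (1 - Phi y) * m (- y) = Phi y * m y.
Proof.
by rewrite /mills_ratio std_normal_cdfN std_normal_pdfN subKr; ring.
Qed.

End mills_bounds.

(** * The Stein solution *)

Section stein_solution.
Context {R : realType}.
Implicit Types x y z w u t e : R.
Local Notation Phi := (@std_normal_cdf R).
Local Notation m := (@mills_ratio R).

(** The bounded solution of
    [f' w - w * f w = (1 - Phi y) - 1(y < w)], written with
    [mills_ratio w] for [(1 - Phi w) / pdf w] and [mills_ratio (- w)]
    for [Phi w / pdf w]. *)
Definition stein_sol y w : R :=
  if w <= y then (1 - Phi y) * m (- w) else Phi y * m w.

Definition stein_sol' y w : R := w * stein_sol y w + (1 - Phi y) - (y < w)%R%:R.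

Lemma stein_sol_ge0 y w : 0 <= stein_sol y w.
Proof.
rewrite /stein_sol; case: ifP => _; rewrite mulr_ge0// ltW//.
- exact: std_normal_tail_gt0.
- exact: mills_gt0.
- exact: std_normal_cdf_gt0.
- exact: mills_gt0.
Qed.

Lemma mills_continuous : continuous m.
Proof. exact: (is_derive_continuous is_derive_mills). Qed.

Lemma stein_sol_continuous y : continuous (stein_sol y).
Proof.
have -> : stein_sol y = fun w => (1 - Phi y) * m (- Num.min w y) +
    Phi y * (m (Num.max w y) - m y).
  apply/funext => w; rewrite /stein_sol; case: (leP w y) => wy.
    by rewrite subrr mulr0 addr0.
  by rewrite stein_balance; ring.
have cmin : continuous (fun w => Num.min w y).
  by move=> w; apply: continuous_min; [exact: cvg_id|exact: cvg_cst].
have cmax : continuous (fun w => Num.max w y).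
  by move=> w; apply: continuous_max; [exact: cvg_id|exact: cvg_cst].
move=> w; apply: cvgD; apply: cvgM; try exact: cvg_cst.
  apply: (@continuous_comp _ _ _ (fun w => - Num.min w y) m); last exact: mills_continuous.
  by apply: cvgN; exact: cmin.
apply: cvgB; last exact: cvg_cst.
apply: (@continuous_comp _ _ _ (fun w => Num.max w y) m); first exact: cmax.
exact: mills_continuous.
Qed.

Lemma is_derive_stein_sol y w : w != y -> is_derive w 1 (stein_sol y) (stein_sol' y w).
Proof.
rewrite neq_lt => /orP[wy|yw]; rewrite /stein_sol' {2}/stein_sol.
  rewrite (ltW wy) ltNge (ltW wy) /= subr0.
  have near_w : \forall u \near w, u < y by exact: lt_nbhsl.
  apply: (@near_eq_is_derive _ _ _ (fun u => (1 - Phi y) * m (- u))).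
    by apply: filterS near_w => u uy; rewrite /stein_sol (ltW uy).
  apply: is_deriveE (is_derive_scale _ (is_derive_opp_arg (is_derive_mills (- w)))) _.
  by ring.
rewrite leNgt yw /=.
have near_w : \forall u \near w, y < u by exact: lt_nbhsr.
apply: (@near_eq_is_derive _ _ _ (fun u => Phi y * m u)).
  by apply: filterS near_w => u uy; rewrite /stein_sol leNgt uy.
apply: is_deriveE (is_derive_scale _ (is_derive_mills w)) _.
by rewrite mulr1n; ring.
Qed.

End stein_solution.

(** * Size and variation of the Stein solution *)

Section stein_solution_bounds.
Context {R : realType}.
Implicit Types w z u t D r : R.
Local Notation Phi := (@std_normal_cdf R).
Local Notation m := (@mills_ratio R).
Local Notation c0 := (@gauss_mass R).

(** A lower bound for [stein_weight] on [x - 2 * e <= w], the region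
    where the indicators of the shifted half-lines live ([edge_le_weight]). *)
Definition edge_const : R := Num.min (1 - Phi 1) (expR (- 1) / (2 * c0)).

Definition sol_const : R := mills_const * (1 + edge_const^-1) + 4 * c0.

Definition product_const : R := 1 + 2 * c0 + mills_const / edge_const.

Definition slope_const : R := mills_const * (1 + edge_const^-1) + 8 * c0 + 1.

Definition stein_const : R :=
  product_const + 1 + edge_const^-1 + 24 * slope_const + sol_const.

Lemma edge_const_gt0 : 0 < edge_const.
Proof.
rewrite /edge_const lt_min std_normal_tail_gt0 divr_gt0 ?expR_gt0//.
by rewrite mulr_gt0// gauss_mass_gt0.
Qed.

Lemma mills_edge_gt0 : 0 < mills_const / edge_const :> R.
Proof. by rewrite divr_gt0 ?edge_const_gt0// (lt_le_trans ltr01 mills_const_ge1). Qed.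

Lemma sol_const_ge0 : 0 <= sol_const.
Proof.
have h := mills_edge_gt0; have c00 := @gauss_mass_gt0 R.
by rewrite /sol_const; have := @mills_const_ge1 R; lra.
Qed.

Lemma product_const_ge0 : 0 <= product_const.
Proof.
have h := mills_edge_gt0; have c00 := @gauss_mass_gt0 R.
by rewrite /product_const; lra.
Qed.

Lemma slope_const_ge0 : 0 <= slope_const.
Proof.
have h := mills_edge_gt0; have c00 := @gauss_mass_gt0 R.
by rewrite /slope_const; have := @mills_const_ge1 R; lra.
Qed.

Lemma stein_const_ge0 : 0 <= stein_const.
Proof.
have := product_const_ge0; have := slope_const_ge0; have := sol_const_ge0.
have : 0 < edge_const^-1 by rewrite invr_gt0 edge_const_gt0.
by rewrite /stein_const; lra.
Qed.

Definition growth x w : R := (1 + clamp x w) * expR (clamp x w ^+ 2 / 2).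

(** The common scale of all error terms. Below [x] it is the size of the Stein
    solution, which there behaves like [(1 - Phi y) / pdf w]; near [x]
    and above it is bounded below, hence dominates constants. *)
Definition stein_weight x y w : R := (1 - Phi y) * growth x w.

Lemma growth_ge1 x w : 0 <= x -> 1 <= growth x w.
Proof.
move=> x0; have /andP[c0 _] := clamp_itv w x0.
rewrite -[leLHS]mulr1; apply: ler_pM => //; first lra.
by rewrite -expR0 ler_expR divr_ge0// sqr_ge0.
Qed.

Lemma expR_sqr_shift (u v e : R) : 0 <= e -> 64 * e <= 1 -> 0 <= v -> v * e <= 4^-1 ->
  0 <= u <= v + e -> expR (u ^+ 2 / 2) <= 2 * expR (v ^+ 2 / 2).
Proof.
move=> e0 e64 v0 ve /andP[u0 uv].
have : u ^+ 2 <= (v + e) ^+ 2 by rewrite lerXn2r ?nnegrE// addr_ge0.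
have ee : e ^+ 2 <= e by rewrite expr2 ler_piMl; lra.
have ve0 : 0 <= v * e by rewrite mulr_ge0.
rewrite sqrrD => h; apply: (@le_trans _ _ (expR (2^-1) * expR (v ^+ 2 / 2))).
  by rewrite -expRD ler_expR; lra.
rewrite ler_wpM2r//.
have := @expR_le_1D2x R 2^-1; rewrite lexx invr_ge0 ler0n /= => /(_ isT); lra.
Qed.

Section fixed.
Variables (x y e : R).
Hypotheses (x0 : 0 <= x) (e0 : 0 < e) (e64 : 64 * e <= 1) (xe : x * e <= 8^-1).
Hypothesis (yx : x - e <= y <= x + e).
Local Notation q := (1 - Phi y).
Local Notation V := (clamp x).
Local Notation wt := (stein_weight x y).

Lemma weight_ge_tail w : q <= wt w.
Proof. by rewrite ler_peMr ?growth_ge1// ltW// std_normal_tail_gt0. Qed.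

Lemma clampD_le w (a : R) : 0 <= a -> V (w + a) <= V w + a.
Proof.
move=> a0; rewrite /clamp ge_max; apply/andP; split.
  by rewrite addr_ge0// le_max lexx.
have : Num.min (w + a) x <= Num.min w x + a.
  by rewrite addr_minl le_min !ge_min lexx lerDl a0 /= orbT.
by move=> /le_trans; apply; rewrite lerD2r le_max lexx orbT.
Qed.

Lemma le_clampD z : z <= x + e -> z <= V z + e.
Proof.
have := x0; have := e0.
by rewrite /clamp; case: (leP z x) => ?; [case: (leP 0 z)|case: (leP 0 x)] => ? ? ? ?; lra.
Qed.

Lemma clamp_near z : x - 2 * e <= z -> x - 2 * e <= V z.
Proof.
have := x0; have := e0.
by rewrite /clamp; case: (leP z x) => ?; [case: (leP 0 z)|case: (leP 0 x)] => ? ? ? ?; lra.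
Qed.

(** If [y <= 1], the tail at [y] is bounded below. Otherwise it is at least
    [pdf y / (2 * y)], and [clamp x w] is at least [y - 3 * e], so
    that [exp (clamp x w ^+ 2 / 2)] makes up for the density. *)
Lemma edge_le_weight w : x - 2 * e <= w -> edge_const <= wt w.
Proof.
move=> /clamp_near wV; have q0 := std_normal_tail_gt0 y.
have e0' := e0; have e64' := e64; have xe' := xe; have x0' := x0.
have /andP[y1 y2] := yx.
have /andP[V0 Vx] := clamp_itv w x0.
have g1 := growth_ge1 w x0.
have [yl|yg] := leP y 1.
  rewrite (@le_trans _ _ (1 - Phi 1)) ?ge_min ?lexx//.
  by rewrite (le_trans (std_normal_tail_decr yl))// ler_peMr// ltW.
rewrite (@le_trans _ _ (expR (- 1) / (2 * c0))) ?ge_min ?lexx ?orbT//.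
rewrite /stein_weight /growth std_normal_tailE -[normal_pdf 0 1 y]invrK std_normal_pdfV.
have ey : y * e <= 4^-1.
  have : y * e <= (x + e) * e by rewrite ler_wpM2r// ltW.
  have : e * e <= e * 1 by rewrite ler_wpM2l; lra.
  lra.
have ml : (2 * y)^-1 <= m y.
  apply: le_trans (mills_lower y); rewrite -[leLHS]div1r ler_pdivrMr; last lra.
  rewrite mulrAC ler_pdivlMr; last by have := sqr_ge0 y; lra.
  have : 0 <= (y - 1) * (y + 1) by apply: mulr_ge0; lra.
  lra.
have Vy : y <= 1 + V w by lra.
have ex : expR (- 1) <= expR (V w ^+ 2 / 2) / expR (y ^+ 2 / 2).
  rewrite -expRN -expRD ler_expR.
  have h1 : y - 3 * e <= V w by lra.
  have h2 : 0 <= y - 3 * e by lra.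
  have : (y - 3 * e) ^+ 2 <= V w ^+ 2 by rewrite lerXn2r ?nnegrE.
  have := sqr_ge0 e; rewrite sqrrB; lra.
have c00 : 0 < c0 := gauss_mass_gt0.
have E0 : 0 < expR (y ^+ 2 / 2) := expR_gt0 _.
have bc0 : 0 <= expR (V w ^+ 2 / 2) / expR (y ^+ 2 / 2) by rewrite divr_ge0.
move: (expR (- 1)) (expR (V w ^+ 2 / 2)) (expR (y ^+ 2 / 2)) E0 ex bc0 => a b c c1 ex bc0.
move: (@gauss_mass R) c00 => k k0.
rewrite (_ : m y / (k * c) * ((1 + V w) * b) = (m y * (1 + V w)) * (b / c) / k); last first.
  by field; rewrite !lt0r_neq0.
rewrite (_ : a / (2 * k) = 2^-1 * a / k); last by field; rewrite !lt0r_neq0.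
rewrite ler_pM2r ?invr_gt0//.
have h : 2^-1 <= m y * (1 + V w).
  apply: (@le_trans _ _ ((2 * y)^-1 * y)).
    have yn : y != 0 by apply: lt0r_neq0; lra.
    by rewrite (_ : (2 * y)^-1 * y = 2^-1)//; field.
  by apply: ler_pM => //; [rewrite invr_ge0; lra|lra].
apply: (@le_trans _ _ (2^-1 * (b / c))).
  by rewrite ler_wpM2l.
by rewrite ler_wpM2r.
Qed.

Lemma indicator_le_weight z w : x - 2 * e <= z -> z < w ->
  1 <= wt w / edge_const.
Proof.
move=> xz zw; rewrite ler_pdivlMr ?edge_const_gt0// mul1r.
by apply: edge_le_weight; rewrite (le_trans xz)// ltW.
Qed.

Lemma mid_exp w : 0 < w -> w <= x + e -> expR (w ^+ 2 / 2) <= 2 * expR (V w ^+ 2 / 2).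
Proof.
move=> w0 wx; have /andP[V0 Vx] := clamp_itv w x0.
apply: (expR_sqr_shift (ltW e0) e64) => //.
  have : V w * e <= x * e by rewrite ler_wpM2r// ltW.
  by have := xe; lra.
by rewrite (ltW w0) le_clampD.
Qed.

(** Clamping moves [w] by at most [e], which changes [exp (w ^+ 2 / 2)]
    at most by a factor [2]. *)
Lemma mid_weight w : 0 < w -> w <= x + e ->
  [/\ 1 + w <= 2 * (1 + V w) & (1 - Phi y) * m (- w) * (1 + V w) <= 2 * c0 * wt w].
Proof.
move=> w0 wx; have /andP[V0 Vx] := clamp_itv w x0.
have := le_clampD wx; have e64' := e64 => wV; split; first lra.
have h : m (- w) <= c0 * (2 * expR (V w ^+ 2 / 2)).
  apply: (le_trans (millsN_le w)).
  by rewrite ler_pM2l ?gauss_mass_gt0//; exact: mid_exp.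
rewrite -mulrA.
apply: (@le_trans _ _ (q * (c0 * (2 * expR (V w ^+ 2 / 2)) * (1 + V w)))).
  rewrite ler_pM2l ?std_normal_tail_gt0//; apply: ler_wpM2r => //; lra.
by rewrite /stein_weight /growth le_eqVlt; apply/orP; left; apply/eqP; ring.
Qed.

Lemma y_geN1 : - 1 <= y.
Proof. by have := yx; have := x0; have := e64; have := e0; move=> ? ? ? /andP[? ?]; lra. Qed.

Lemma weight_gt0 w : 0 < wt w.
Proof. exact: lt_le_trans (std_normal_tail_gt0 y) (weight_ge_tail w). Qed.

Lemma const_le_right w (c : R) : 0 <= c -> y < w -> c <= c / edge_const * wt w.
Proof.
move=> c00 yw; rewrite -mulrA ler_peMr// mulrC; apply: indicator_le_weight yw.
by have /andP[? ?] := yx; have := e0; lra.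
Qed.

Lemma stein_sol_neg w : w <= 0 -> w <= y ->
  (1 + w ^+ 2) * stein_sol y w <= mills_const * ((1 + `|w|) * wt w).
Proof.
move=> w0 wy; rewrite /stein_sol wy.
have h : (1 + w ^+ 2) * m (- w) <= mills_const * (1 + `|w|).
  by rewrite -sqrrN -normrN sqr_mills_le_abs//; lra.
rewrite mulrCA mulrC (mulrA mills_const); apply: ler_pM => //.
- by apply: mulr_ge0; [rewrite addr_ge0 ?sqr_ge0|exact: ltW (mills_gt0 _)].
- exact: ltW (std_normal_tail_gt0 y).
- exact: weight_ge_tail.
Qed.

Lemma stein_sol_mid w : 0 < w -> w <= y ->
  (1 + w ^+ 2) * stein_sol y w <= 4 * c0 * ((1 + `|w|) * wt w).
Proof.
move=> w0 wy; rewrite /stein_sol wy.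
have wxe : w <= x + e by have /andP[_ ?] := yx; exact: le_trans wy _.
have [h1 h2] := mid_weight w0 wxe.
rewrite ger0_norm ?(ltW w0)//.
apply: (@le_trans _ _ ((1 + w) * (2 * (1 + V w)) * (q * m (- w)))).
  apply: ler_wpM2r.
    by apply: mulr_ge0; apply: ltW; [exact: std_normal_tail_gt0|exact: mills_gt0].
  have : (1 + w) * (1 + w) <= (1 + w) * (2 * (1 + V w)) by rewrite ler_wpM2l//; lra.
  lra.
have : (1 + w) * (q * m (- w) * (1 + V w)) <= (1 + w) * (2 * c0 * wt w).
  by rewrite ler_wpM2l//; lra.
by move: (q * m (- w)) (V w) (wt w) => X v z; lra.
Qed.

Lemma stein_sol_right w : y < w ->
  (1 + w ^+ 2) * stein_sol y w <= mills_const / edge_const * ((1 + `|w|) * wt w).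
Proof.
move=> yw; rewrite /stein_sol (leNgt w) yw /=.
have h : (1 + w ^+ 2) * m w <= mills_const * (1 + `|w|).
  by rewrite sqr_mills_le_abs// (le_trans y_geN1)// ltW.
have mc1 := @mills_const_ge1 R; have a0 : 0 <= `|w| by [].
have h2 : mills_const * (1 + `|w|) <= mills_const / edge_const * ((1 + `|w|) * wt w).
  rewrite (_ : _ / _ * _ = mills_const * (1 + `|w|) / edge_const * wt w); last by ring.
  by apply: const_le_right yw; rewrite mulr_ge0//; lra.
apply: le_trans h2; apply: le_trans h; rewrite mulrCA ler_piMl//.
  by apply: mulr_ge0; [rewrite addr_ge0 ?sqr_ge0|exact: ltW (mills_gt0 _)].
by have := std_normal_tail_gt0 y; lra.
Qed.

(** To the left of [0] and to the right of [y] the solution is a Mills ratio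
    at an argument not below [-1]; in between it is of the size of the
    reciprocal density. *)
Lemma stein_sol_bound w :
  (1 + w ^+ 2) * stein_sol y w <= sol_const * ((1 + `|w|) * wt w).
Proof.
have A0 : 0 <= (1 + `|w|) * wt w by rewrite mulr_ge0// ltW// weight_gt0.
have mc1 := @mills_const_ge1 R; have me0 := mills_edge_gt0.
have c00 := @gauss_mass_gt0 R.
have [yw|wy] := ltP y w.
  apply: (le_trans (stein_sol_right yw)); apply: ler_wpM2r => //.
  by rewrite /sol_const; lra.
have [w0|w0] := leP w 0.
  apply: (le_trans (stein_sol_neg w0 wy)); apply: ler_wpM2r => //.
  by rewrite /sol_const; lra.
apply: (le_trans (stein_sol_mid w0 wy)); apply: ler_wpM2r => //.
by rewrite /sol_const; lra.
Qed.

Lemma stein_product_bound w : `|w * stein_sol y w| <= product_const * wt w.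
Proof.
have q0 := std_normal_tail_gt0 y; have qw := weight_ge_tail w.
have wt0 := ltW (weight_gt0 w).
have mc1 := @mills_const_ge1 R; have me0 := mills_edge_gt0.
have c00 := @gauss_mass_gt0 R.
rewrite normrM (ger0_norm (stein_sol_ge0 y w)) /stein_sol; case: (leP w y) => wy.
  have mm := mills_gt0 (- w); have [w0|w0] := leP w 0.
    rewrite (ler0_norm w0) mulrCA; apply: (@le_trans _ _ (q * 1)).
      by rewrite ler_pM2l// mills_upper.
    rewrite mulr1 (le_trans qw)// ler_peMl// /product_const; lra.
  have wxe : w <= x + e by have /andP[_ ?] := yx; exact: le_trans wy _.
  have [_ h2] := mid_weight w0 wxe.
  have h3 : w <= 1 + V w by have := le_clampD wxe; have := e64; lra.
  rewrite (gtr0_norm w0) mulrC (@le_trans _ _ (2 * c0 * wt w))//.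
    apply: le_trans h2; apply: ler_wpM2l => //.
    by apply: mulr_ge0; exact: ltW.
  by apply: ler_wpM2r => //; rewrite /product_const; lra.
have w1 : - 1 <= w by rewrite (le_trans y_geN1)// ltW.
have h : `|w| * m w <= mills_const.
  have [w0|w0] := leP 0 w; first by rewrite ger0_norm// (le_trans (mills_upper w)).
  apply: (@le_trans _ _ (1 * m w)); last by rewrite mul1r mills_le_const.
  by apply: ler_wpM2r; [exact: ltW (mills_gt0 w)|rewrite ltr0_norm//; lra].
apply: (@le_trans _ _ mills_const).
  apply: le_trans h; rewrite mulrCA ler_piMl//; last lra.
  by apply: mulr_ge0 => //; exact: ltW (mills_gt0 w).
apply: (le_trans (const_le_right _ wy)); first lra.
by apply: ler_wpM2r => //; rewrite /product_const; lra.
Qed.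

(** The derivative of [w * stein_sol y w], after substitution of the Stein
    equation. *)
Definition stein_slope z : R :=
  (1 + z ^+ 2) * stein_sol y z + z * ((1 - Phi y) - (y < z)%R%:R).

Lemma is_derive_stein_product z : z != y ->
  is_derive z 1 (fun w => w * stein_sol y w) (stein_slope z).
Proof.
move=> zy; apply: is_deriveE (is_derive_mul (is_derive_idR z) (is_derive_stein_sol zy)) _.
by rewrite /stein_slope /stein_sol'; ring.
Qed.

Lemma stein_slope_neg z : z <= 0 -> z <= y -> `|stein_slope z| <= mills_const * wt z.
Proof.
move=> z0 zy; rewrite /stein_slope /stein_sol zy (ltNge y) zy /= subr0.
have q0 := std_normal_tail_gt0 y.
have /mills_slope : - 1 <= - z by lra.
rewrite sqrrN opprK => /andP[h1 h2].
rewrite [X in `|X|](_ : _ = q * ((1 + z ^+ 2) * m (- z) + z)); last by ring.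
rewrite ger0_norm; last by apply: mulr_ge0 => //; exact: ltW.
rewrite mulrC; apply: ler_pM => //; [exact: ltW|exact: weight_ge_tail].
Qed.

Lemma stein_slope_mid z : 0 < z -> z <= y ->
  `|stein_slope z| <= (8 * c0 + 1) * ((1 + V z) * wt z).
Proof.
move=> z0 zy; rewrite /stein_slope /stein_sol zy (ltNge y) zy /= subr0.
have q0 := std_normal_tail_gt0 y; have mm := mills_gt0 (- z).
have zxe : z <= x + e by have /andP[_ ?] := yx; exact: le_trans zy _.
have [h1 h2] := mid_weight z0 zxe.
have h3 : z <= 1 + V z by have := le_clampD zxe; have := e64; lra.
have qm0 : 0 <= q * m (- z) by apply: mulr_ge0; exact: ltW.
have h4 : z * q <= (1 + V z) * wt z.
  by apply: ler_pM; [exact: ltW|exact: ltW|exact: h3|exact: weight_ge_tail].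
have h5 : (1 + z ^+ 2) * (q * m (- z)) <= 8 * c0 * ((1 + V z) * wt z).
  apply: (@le_trans _ _ ((2 * (1 + V z)) * (2 * (1 + V z)) * (q * m (- z)))).
    apply: ler_wpM2r => //.
    have : (1 + z) * (1 + z) <= (2 * (1 + V z)) * (2 * (1 + V z)) by apply: ler_pM => //; lra.
    lra.
  have : (1 + V z) * (q * m (- z) * (1 + V z)) <= (1 + V z) * (2 * c0 * wt z).
    by apply: ler_wpM2l => //; lra.
  by move: (q * m (- z)) (wt z) (V z) => X p v; lra.
have h6 : 0 <= (1 + z ^+ 2) * (q * m (- z)) + z * q.
  by apply: addr_ge0; apply: mulr_ge0 => //; [rewrite addr_ge0 ?sqr_ge0|exact: ltW..].
by rewrite ger0_norm// [leRHS]mulrDl mul1r lerD.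
Qed.

Lemma stein_slope_right z : y < z -> `|stein_slope z| <= mills_const / edge_const * wt z.
Proof.
move=> yz; rewrite /stein_slope /stein_sol (leNgt z) yz /=.
have P0 := std_normal_cdf_gt0 y.
have /mills_slope/andP[h1 h2] : - 1 <= z by rewrite (le_trans y_geN1)// ltW.
rewrite [X in `|X|](_ : _ = Phi y * ((1 + z ^+ 2) * m z - z)); last by rewrite mulr1n; ring.
rewrite ger0_norm; last by apply: mulr_ge0 => //; exact: ltW.
have mc1 := @mills_const_ge1 R.
apply: le_trans (const_le_right _ yz); last lra.
rewrite -[leRHS]mul1r; apply: ler_pM => //; first exact: ltW.
by have := std_normal_tail_gt0 y; lra.
Qed.

(** In the outer regions the factor of [1 - Phi y], respectively of
    [Phi y], is the expression bounded in [mills_slope]; the large terms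
    cancel. *)
Lemma stein_slope_bound z : `|stein_slope z| <= slope_const * ((1 + V z) * wt z).
Proof.
have /andP[V0 _] := clamp_itv z x0; have wt0 := weight_gt0 z.
have wV : wt z <= (1 + V z) * wt z by rewrite ler_peMl ?lerDl// ltW.
have A0 : 0 <= (1 + V z) * wt z by exact: le_trans (ltW wt0) wV.
have mc1 := @mills_const_ge1 R; have me0 := mills_edge_gt0.
have c00 := @gauss_mass_gt0 R.
have [yz|zy] := ltP y z.
  apply: (le_trans (stein_slope_right yz)); apply: ler_pM => //; [exact: ltW|exact: ltW|].
  by rewrite /slope_const; lra.
have [z0|z0] := leP z 0.
  apply: (le_trans (stein_slope_neg z0 zy)); apply: ler_pM => //; [lra|exact: ltW|].
  by rewrite /slope_const; lra.
apply: (le_trans (stein_slope_mid z0 zy)); apply: ler_wpM2r => //.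
by rewrite /slope_const; lra.
Qed.

Lemma weight_shift z w : `|z - w| <= e ->
  (1 + V z) * wt z <= 8 * ((1 + V w) * wt w).
Proof.
rewrite ler_norml => /andP[_ zw].
have [e0' e64'] := (e0, e64).
have /andP[V0 Vx] := clamp_itv w x0; have /andP[U0 Ux] := clamp_itv z x0.
have VV : V z <= V w + e.
  by apply: (le_trans (clamp_mono x _)) (clampD_le _ (ltW e0)); lra.
have ex : expR (V z ^+ 2 / 2) <= 2 * expR (V w ^+ 2 / 2).
  apply: (expR_sqr_shift (ltW e0) e64) => //; last by rewrite U0.
  have : V w * e <= x * e by rewrite ler_wpM2r// ltW.
  by have := xe; lra.
have h : 1 + V z <= 2 * (1 + V w) by lra.
have q0 := ltW (std_normal_tail_gt0 y).
rewrite /stein_weight /growth.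
rewrite (_ : 8 * _ = (2 * (1 + V w)) * (q * ((2 * (1 + V w)) * (2 * expR (V w ^+ 2 / 2)))));
  last by ring.
apply: ler_pM => //; [lra| |].
  by apply: mulr_ge0 => //; apply: mulr_ge0 => //; lra.
by apply: ler_wpM2l => //; apply: ler_pM => //; lra.
Qed.

(** The slope at a point between [w] and [w + t] is compared with the weight
    at [w] by [weight_shift]. *)
Lemma stein_product_variation w t : - e <= t <= e ->
  `|(w + t) * stein_sol y (w + t) - w * stein_sol y w| <=
  e * (8 * slope_const * ((1 + V w) * wt w)).
Proof.
move=> /andP[t1 t2].
pose B := 8 * slope_const * ((1 + V w) * wt w).
have cg : continuous (fun w => w * stein_sol y w).
  by move=> z; apply: cvgM; [exact: cvg_id|exact: stein_sol_continuous].
have sc0 := slope_const_ge0.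
have bd a b : a <= b -> (forall z, a < z < b -> `|z - w| <= e) ->
    `|b * stein_sol y b - a * stein_sol y a| <= B * (b - a).
  move=> ab near; apply: (@mean_value_ineq _ (fun w => w * stein_sol y w) stein_slope [:: y]) => // z zab.
  rewrite inE => zy; split; first exact: is_derive_stein_product.
  rewrite (le_trans (stein_slope_bound z))// /B.
  have := weight_shift (near z zab).
  move=> h; have : slope_const * ((1 + V z) * wt z) <= slope_const * (8 * ((1 + V w) * wt w)).
    by apply: ler_wpM2l.
  lra.
have B0 : 0 <= B.
  have /andP[V0 _] := clamp_itv w x0.
  have wt0 := ltW (weight_gt0 w).
  apply: mulr_ge0; first lra.
  by apply: mulr_ge0 => //; lra.
rewrite -/B; have [t0|t0] := leP 0 t.
  apply: (@le_trans _ _ (B * (w + t - w))).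
    apply: bd => [|z /andP[z1 z2]]; first lra.
    rewrite ger0_norm; lra.
  by rewrite mulrC ler_wpM2r//; lra.
rewrite distrC; apply: (@le_trans _ _ (B * (w - (w + t)))).
  apply: bd => [|z /andP[z1 z2]]; first lra.
  rewrite ler0_norm; lra.
by rewrite mulrC ler_wpM2r//; lra.
Qed.

End fixed.
End stein_solution_bounds.

(** * Comparison with the normal tail at a shifted point *)

(** Since [D] is close to [1], replacing [D] by [1] in front of [g] and of
    [q - i] costs [e * (1 + a)] times the weight. The two conclusions
    are for a test function and its opposite. *)
Lemma stein_test_algebra {R : realType} (e a D r f g s q i wt K1 K2 K3 K4 : R) :
  0 < e -> 0 <= a -> 0 <= wt -> 0 <= s -> 0 <= K4 ->
  `|D - 1| <= e * (1 + a) -> `|g| <= K2 * wt -> 0 <= q <= wt -> 0 <= i <= K4 * wt ->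
  `|r| * f <= e * (K1 * ((1 + a) * wt)) -> 0 <= f -> D * s <= e * (K3 * ((1 + a) * wt)) ->
  D * (g + s + (q - i)) + r * f - g <=
    (q - i) + e * (K2 + 1 + K4 + K3 + K1) * ((1 + a) * wt) /\
  D * (- g + s - (q - i)) - r * f + g <=
    - (q - i) + e * (K2 + 1 + K4 + K3 + K1) * ((1 + a) * wt).
Proof.
move=> e0 a0 wt0 s0 K40 hD hg /andP[q0 qw] /andP[i0 iw] hr f0 hs.
have hG : `|g + (q - i)| <= (K2 + 1 + K4) * wt.
  have : `|g + (q - i)| <= `|g| + `|q - i| by exact: ler_normD.
  have : `|q - i| <= q + i by rewrite ler_norml; apply/andP; split; lra.
  lra.
have hDG : `|(D - 1) * (g + (q - i))| <= e * (1 + a) * ((K2 + 1 + K4) * wt).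
  by rewrite normrM; apply: ler_pM.
have hrf : `|r * f| <= e * (K1 * ((1 + a) * wt)) by rewrite normrM (ger0_norm f0).
move: hDG hrf; rewrite !ler_norml => /andP[h1 h2] /andP[h3 h4].
have E : e * (K2 + 1 + K4 + K3 + K1) * ((1 + a) * wt) =
  e * (1 + a) * ((K2 + 1 + K4) * wt) + e * (K3 * ((1 + a) * wt)) + e * (K1 * ((1 + a) * wt)).
  by ring.
by rewrite E; split; lra.
Qed.

Lemma indicator_shift_right {R : realType} (y e w t : R) : - e <= t ->
  (y + e < w)%R%:R <= (y < w + t)%R%:R :> R.
Proof. by move=> t1; rewrite ler_nat; case: ltP => // h1; case: ltP => // h2; lra. Qed.

Lemma indicator_shift_left {R : realType} (y e w t : R) : t <= e ->
  (y < w + t)%R%:R <= (y - e < w)%R%:R :> R.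
Proof. by move=> t2; rewrite ler_nat; case: ltP => // h1; case: ltP => // h2; lra. Qed.

Lemma measurable_gt_indicator {R : realType} (z : R) :
  measurable_fun [set: R] (fun w : R => (z < w)%R%:R : R).
Proof.
rewrite (_ : (fun w => _) = fun w : R => if z < w then 1 else 0); last first.
  by apply/funext => w; case: ifP.
by apply: measurable_fun_ifT => //; exact: measurable_fun_ltr.
Qed.

Section tail_comparison.
Context {d} {T : measurableType d} {R : realType}.
Variables (P : probability T R) (W Rem : {RV P >-> R}) (mu : R.-sfker T ~> R).
Variables (delta : R) (EDW ERW : T -> R) (e al : R).
Hypothesis small : small_remainders W Rem mu delta EDW ERW e al.
Local Notation Phi := (@std_normal_cdf R).

Definition tail_prob (z : R) : R := fine (P [set w | W w > z]).

Lemma measurable_gt (z : R) : measurable [set w | z < W w].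
Proof.
rewrite (_ : [set w | _] = W @^-1` `]z, +oo[); last first.
  by apply/seteqP; split=> w /=; rewrite in_itv /= andbT.
by rewrite -[_ @^-1` _]setTI; exact: (measurable_funPT W).
Qed.

Lemma tail_prob01 (z : R) : 0 <= tail_prob z <= 1.
Proof.
have mA := measurable_gt z.
rewrite /tail_prob fine_ge0//= -lee_fin fineK ?fin_num_measure//.
exact: probability_le1.
Qed.

Lemma Rintegral_gt_indicator (z : R) :
  \int[P]_w (z < W w)%R%:R = tail_prob z /\
  P.-integrable [set: T] (fun w => (z < W w)%R%:R%:E).
Proof.
have mA := measurable_gt z.
have E : (fun w => (z < W w)%R%:R : R) = \1_[set w | z < W w].
  by apply/funext => w; rewrite indicE mem_setE.
split.
  rewrite /tail_prob /Rintegral (_ : (fun w => _) = EFin \o \1_[set w | z < W w]).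
    by rewrite integral_indic// setIT.
  by rewrite -E.
rewrite (_ : (fun w => _) = EFin \o \1_[set w | z < W w]); last by rewrite -E.
by apply: integrable_indic.
Qed.

Variables (x y : R).
Hypotheses (x0 : 0 <= x) (x3e : x ^+ 3 * e <= 4) (yx : x - e <= y <= x + e).
Local Notation q := (1 - Phi y).
Local Notation wt := (stein_weight x y).

Let e0 := sr_e_gt0 small.
Let e64 := sr_e64 small.

Let xe : x * e <= 8^-1.
Proof. by have [] := tilt_rateP x0 e0 e64 (sr_e small) x3e. Qed.

(** [D] may be as large as [1 + e * (1 + a)], but
    [e * (1 + v) <= 1] as [v <= x], so that the unbounded factors do
    not multiply. *)
Lemma variation_budget (a v D s : R) : 0 <= v <= a -> v <= x -> `|D - 1| <= e * (1 + a) ->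
  0 <= s -> D * (e * (8 * slope_const * ((1 + v) * s))) <=
  e * (24 * slope_const * ((1 + a) * s)).
Proof.
move=> /andP[v0 va] vx; rewrite ler_norml => /andP[_ hD] s0.
have [e0' e64'] := (e0, e64); have xe' := xe; have sc0 := @slope_const_ge0 R.
have a0 : 0 <= a by exact: le_trans va.
have Dv : D * (1 + v) <= 3 * (1 + a).
  have h1 : D * (1 + v) <= (1 + e * (1 + a)) * (1 + v) by apply: ler_wpM2r; lra.
  have h2 : (e * (1 + v)) * (1 + a) <= 1 * (1 + a).
    apply: ler_wpM2r; first lra.
    have : e * v <= e * x by rewrite ler_pM2l.
    lra.
  lra.
rewrite (_ : D * _ = e * (8 * slope_const * (D * (1 + v) * s))); last by ring.
rewrite ler_pM2l// (_ : 24 * slope_const * _ = 8 * slope_const * (3 * (1 + a) * s)); last by ring.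
by apply: ler_wpM2l; [lra|exact: ler_wpM2r].
Qed.

Lemma clamp_le_abs w : clamp x w <= `|w|.
Proof.
rewrite /clamp ge_max normr_ge0 /= (@le_trans _ _ w) ?ler_norm// ge_min lexx//.
Qed.

(** Bounds the change of [w * stein_sol y w] over a distance [e]. *)
Definition stein_variation (w : R) : R :=
  e * (8 * slope_const * ((1 + clamp x w) * wt w)).

Definition stein_error (w : R) : R := e * stein_const * ((1 + `|w|) * wt w).

(** What [stein_pointwise] asks of the Stein solution and of its opposite,
    with [stein_error] for the cost. *)
Lemma stein_tests_pointwise (w D r : R) :
  `|D - 1| <= e * (1 + `|w|) -> `|r| <= e * (1 + w ^+ 2) ->
  let g := w * stein_sol y w in
  let s := stein_variation w in
  D * (g + s + (q - (y + e < w)%R%:R)) + r * stein_sol y w - g <=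
    (q - (y + e < w)%R%:R) + stein_error w /\
  D * (- g + s - (q - (y - e < w)%R%:R)) - r * stein_sol y w + g <=
    - (q - (y - e < w)%R%:R) + stein_error w.
Proof.
move=> hD hr g s; have [e0' e64'] := (e0, e64).
have /andP[V0 Vx] := clamp_itv w x0.
have q0 := std_normal_tail_gt0 y.
have wt0 := ltW (weight_gt0 y x0 w).
have a0 : 0 <= `|w| by [].
have sc0 := @slope_const_ge0 R.
have s0 : 0 <= s.
  apply: mulr_ge0; first exact: ltW.
  by apply: mulr_ge0; [lra|apply: mulr_ge0 => //; lra].
have K40 : 0 <= (@edge_const R)^-1 by rewrite invr_ge0 ltW// edge_const_gt0.
have hg := stein_product_bound x0 e0 e64 xe yx w.
have hf := stein_sol_bound x0 e0 e64 xe yx w.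
have f0 := stein_sol_ge0 y w.
have hrf : `|r| * stein_sol y w <= e * (sol_const * ((1 + `|w|) * wt w)).
  apply: (@le_trans _ _ (e * (1 + w ^+ 2) * stein_sol y w)); first exact: ler_wpM2r.
  by rewrite -mulrA ler_pM2l.
have hs : D * s <= e * (24 * slope_const * ((1 + `|w|) * wt w)).
  by apply: variation_budget => //; rewrite V0 clamp_le_abs.
have hi (z : R) : x - 2 * e <= z -> 0 <= ((z < w)%R%:R : R) <= edge_const^-1 * wt w.
  move=> xz; rewrite ler0n /=; case: (ltP z w) => zw /=; last by rewrite mulr_ge0.
  by rewrite mulrC (indicator_le_weight x0 e0 e64 xe yx xz zw).
have /andP[y1 y2] := yx.
have qw : 0 <= q <= wt w by rewrite (ltW q0) weight_ge_tail.
have z1 : x - 2 * e <= y + e by lra.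
have z2 : x - 2 * e <= y - e by lra.
have [h1 _] := stein_test_algebra e0 a0 wt0 s0 K40 hD hg qw (hi _ z1) hrf f0 hs.
have [_ h2] := stein_test_algebra e0 a0 wt0 s0 K40 hD hg qw (hi _ z2) hrf f0 hs.
by [].
Qed.

Lemma growth_continuous : continuous (growth x).
Proof.
have cc := clamp_continuous (x := x).
move=> w; apply: cvgM; first by apply: cvgD; [exact: cvg_cst|exact: cc].
apply: (@continuous_comp _ _ _ (clamp x) (fun v => expR (v ^+ 2 / 2))); first exact: cc.
apply: (@is_derive_continuous _ (fun v : R => expR (v ^+ 2 / 2))
  (fun v => (2 * v * 2^-1 + v ^+ 2 * 0) * expR (v ^+ 2 / 2))) => v.
exact: is_derive_exp (is_derive_mul (is_derive_sqr v) (is_derive_cst (2^-1 : R) v 1)).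
Qed.

Lemma growth_le w : growth x w <= (1 + x) * expR (x ^+ 2 / 2).
Proof.
have /andP[V0 Vx] := clamp_itv w x0.
apply: ler_pM => //; [lra|lra|].
by rewrite ler_expR ler_wpM2r// lerXn2r ?nnegrE.
Qed.

(** The error is a multiple of [moment_weight]. *)
Lemma mean_stein_error :
  P.-integrable [set: T] (fun w => (stein_error (W w))%:E) /\
  \int[P]_w stein_error (W w) <= q * (e * stein_const * (moment_const al * (1 + x ^+ 3))).
Proof.
have iM := integrable_moment_weight small x0.
have E w : stein_error w = q * (e * stein_const) * moment_weight x w.
  by rewrite /stein_error /stein_weight /growth /moment_weight; ring.
have K0 := @stein_const_ge0 R.
split.
  have := integrableZl measurableT (q * (e * stein_const)) iM.
  by apply: eq_integrable => // w _; rewrite E EFinM.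
under eq_Rintegral do rewrite E.
rewrite RintegralZl// [leRHS]mulrA; apply: ler_wpM2l.
  apply: mulr_ge0; first exact: ltW (std_normal_tail_gt0 y).
  by apply: mulr_ge0 => //; exact: ltW.
exact: (mean_moment_weight_le small x0 x3e).
Qed.

Let wt_ge0 w : 0 <= wt w.
Proof. exact: ltW (weight_gt0 y x0 w). Qed.

Let wt_le w : wt w <= (1 + x) * expR (x ^+ 2 / 2).
Proof.
rewrite (le_trans _ (growth_le w))// ler_piMl//.
  exact: le_trans ler01 (growth_ge1 w x0).
by have := std_normal_cdf_gt0 y; lra.
Qed.

Let stein_variation_ge0 w : 0 <= stein_variation w.
Proof.
have /andP[V0 _] := clamp_itv w x0; have sc0 := @slope_const_ge0 R.
apply: mulr_ge0; first exact: ltW.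
apply: mulr_ge0; first exact: mulr_ge0.
by apply: mulr_ge0; [exact: addr_ge0|exact: wt_ge0].
Qed.

Lemma stein_product_bounded : exists B : R, forall w, `|w * stein_sol y w| <= B.
Proof.
exists (product_const * ((1 + x) * expR (x ^+ 2 / 2))) => w.
apply: (le_trans (stein_product_bound x0 e0 e64 xe yx w)).
by apply: ler_wpM2l => //; exact: product_const_ge0.
Qed.

Lemma stein_sol_bounded : exists B : R, forall w, `|stein_sol y w| <= B.
Proof.
have [B gB] := stein_product_bounded.
pose A := (1 + x) * expR (x ^+ 2 / 2).
have so0 := @sol_const_ge0 R.
have A0 : 0 <= A := le_trans (wt_ge0 0) (wt_le 0).
exists (B + sol_const * (2 * A)) => w.
have B0 : 0 <= B := le_trans (normr_ge0 _) (gB 0).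
have sA0 : 0 <= sol_const * (2 * A) by apply: mulr_ge0 => //; exact: mulr_ge0.
have f0 := stein_sol_ge0 y w; rewrite ger0_norm//.
have [w1|w1] := leP `|w| 1.
  apply: (@le_trans _ _ ((1 + w ^+ 2) * stein_sol y w)).
    by rewrite ler_peMl// lerDl sqr_ge0.
  apply: (le_trans (stein_sol_bound x0 e0 e64 xe yx w)).
  apply: (@le_trans _ _ (sol_const * (2 * A))); last by rewrite lerDr.
  by apply: ler_wpM2l => //; apply: ler_pM => //; rewrite -natr1 lerD2l.
apply: (@le_trans _ _ B); last by rewrite lerDl.
apply: le_trans (gB w); rewrite normrM (ger0_norm f0) ler_peMl//; exact: ltW.
Qed.

Lemma stein_variation_bounded : exists B : R, forall w, `|stein_variation w| <= B.
Proof.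
exists (e * (8 * slope_const * ((1 + x) * ((1 + x) * expR (x ^+ 2 / 2))))) => w.
have /andP[V0 Vx] := clamp_itv w x0.
rewrite ger0_norm// /stein_variation ler_pM2l//; apply: ler_wpM2l.
  by apply: mulr_ge0 => //; exact: slope_const_ge0.
by apply: ler_pM => //; [rewrite addr_ge0|rewrite lerD2l].
Qed.

Lemma tail_centered_le1 (z w : R) : `|q - (z < w)%R%:R| <= 1.
Proof.
have q0 := std_normal_tail_gt0 y; have P0 := std_normal_cdf_gt0 y.
by rewrite ler_norml; case: (z < w); rewrite /= ?mulr1n ?mulr0n; apply/andP; split; lra.
Qed.

(** A qualitative bound, which makes the Stein solution an admissible test
    function. *)
Lemma stein_tests_bounded : exists B : R, forall w z : R,
  [/\ `|stein_sol y w| <= B, `|w * stein_sol y w| <= B, `|stein_sol' y w| <= B,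
   `|w * stein_sol y w + stein_variation w + (q - (z < w)%R%:R)| <= B &
   `|- (w * stein_sol y w) + stein_variation w - (q - (z < w)%R%:R)| <= B].
Proof.
have [B1 h1] := stein_sol_bounded; have [B2 h2] := stein_product_bounded.
have [B3 h3] := stein_variation_bounded.
exists (B1 + B2 + B3 + 1) => w z.
have {}h1 := h1 w; have {}h2 := h2 w; have {}h3 := h3 w.
have hi := tail_centered_le1 z w; have hy := tail_centered_le1 y w.
have i0 := le_trans (normr_ge0 _) h1; have j0 := le_trans (normr_ge0 _) h2.
have k0 := le_trans (normr_ge0 _) h3.
split.
- by rewrite (le_trans h1)// -2!addrA lerDl !addr_ge0.
- by rewrite (le_trans h2)// (addrC B1) -2!addrA lerDl !addr_ge0.
- rewrite /stein_sol' -addrA (le_trans (ler_normD _ _))// -(addrA B1) (addrC B1).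
  by apply: lerD; [apply: ler_wpDr => //; exact: ler_wpDr|].
- rewrite (le_trans (ler_normD _ _))// lerD// (le_trans (ler_normD _ _))//.
  by apply: lerD => //; exact: ler_wpDl.
- rewrite (le_trans (ler_normB _ _))// lerD// (le_trans (ler_normD _ _))// normrN.
  by apply: lerD => //; exact: ler_wpDl.
Qed.

Let cf : continuous (stein_sol y) := @stein_sol_continuous R y.

Let measurable_product : measurable_fun [set: R] (fun w : R => w * stein_sol y w).
Proof.
apply: continuous_measurable_fun => z.
by apply: cvgM; [exact: cvg_id|exact: cf].
Qed.

Let measurable_stein_variation : measurable_fun [set: R] stein_variation.
Proof.
apply: continuous_measurable_fun => w; apply: cvgM; first exact: cvg_cst.
apply: cvgM; first exact: cvg_cst.
apply: cvgM; first by apply: cvgD; [exact: cvg_cst|exact: clamp_continuous].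
by apply: cvgM; [exact: cvg_cst|exact: growth_continuous].
Qed.

Let measurable_centered (z : R) :
  measurable_fun [set: R] (fun w : R => q - (z < w)%R%:R : R).
Proof. by apply: measurable_funB => //; exact: measurable_gt_indicator. Qed.

Let measurable_stein_sol' : measurable_fun [set: R] (stein_sol' y).
Proof.
rewrite (_ : stein_sol' y = fun w => w * stein_sol y w + (q - (y < w)%R%:R)).
  exact: measurable_funD.
by apply/funext => w; rewrite /stein_sol' -addrA.
Qed.

Let integrable_product : P.-integrable [set: T] (fun w => (W w * stein_sol y (W w))%:E).
Proof.
have [B gB] := stein_product_bounded.
exact: (integrable_bounded_comp W measurable_product gB).
Qed.

Let integrable_centered (z : R) :
  P.-integrable [set: T] (EFin \o (fun w => q - (z < W w)%R%:R)).
Proof.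
exact: (integrable_bounded_comp W (measurable_centered z) (tail_centered_le1 z)).
Qed.

Let mean_centered (z : R) : \int[P]_w (q - (z < W w)%R%:R) = q - tail_prob z.
Proof.
have [tp iT] := Rintegral_gt_indicator z.
rewrite RintegralB//; last exact: (@integrable_bounded _ _ _ P (cst q) `|q|).
by rewrite Rintegral_cst1 tp.
Qed.

(** Test function [stein_sol y]. In its derivative at [w + t], the product
    [(w + t) * stein_sol y (w + t)] is within [stein_variation w] of
    its value at [w], and the indicator of [y < w + t] is at least that of
    [y + e < w]. *)
Lemma tail_upper_bound :
  tail_prob (y + e) <= q + q * (e * stein_const * (moment_const al * (1 + x ^+ 3))).
Proof.
have [iErr mErr] := mean_stein_error; have [B hB] := stein_tests_bounded.
suff : 0 <= q - tail_prob (y + e) + \int[P]_w stein_error (W w).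
  by move: (\int[P]_w _) mErr => I; lra.
rewrite -mean_centered -RintegralD//.
apply: (stein_pointwise small (f := stein_sol y) (f' := stein_sol' y) (cs := [:: y])
  (G := fun w => w * stein_sol y w + stein_variation w + (q - (y + e < w)%R%:R)) (B := B)
  (h := fun w => q - (y + e < w)%R%:R + stein_error w)) => //.
- by move=> z; rewrite inE => zy; exact: is_derive_stein_sol.
- by apply: measurable_funD => //; exact: measurable_funD.
- by move=> z; have [] := hB z 0.
- by move=> z; have [] := hB z 0.
- by move=> z; have [] := hB z (y + e).
- move=> w t te; have := stein_product_variation x0 e0 e64 xe yx w te.
  rewrite ler_norml => /andP[_ v2]; have /andP[t1 _] := te.
  rewrite /stein_sol' -(addrA (_ * _)); apply: lerD; last first.
    by rewrite lerD2l lerN2 indicator_shift_right.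
  by rewrite -lerBlDl.
- have := integrableD measurableT (integrable_centered (y + e)) iErr.
  exact: eq_integrable.
- by move=> w D r hD hr _; have [] := stein_tests_pointwise hD hr.
Qed.

(** The opposite test function, for which the indicator of [y < w + t] is
    bounded above, by that of [y - e < w]. *)
Lemma tail_lower_bound :
  q - q * (e * stein_const * (moment_const al * (1 + x ^+ 3))) <= tail_prob (y - e).
Proof.
have [iErr mErr] := mean_stein_error; have [B hB] := stein_tests_bounded.
suff : 0 <= - (q - tail_prob (y - e)) + \int[P]_w stein_error (W w).
  by move: (\int[P]_w _) mErr => I; lra.
have iN : P.-integrable [set: T] (EFin \o (fun w => - (q - (y - e < W w)%R%:R))).
  by have := integrableN (integrable_centered (y - e)); exact: eq_integrable.
have -> : - (q - tail_prob (y - e)) = \int[P]_w (- (q - (y - e < W w)%R%:R)).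
  rewrite -mean_centered -mulN1r -RintegralZl//.
  by apply: eq_Rintegral => w _; rewrite mulN1r.
rewrite -RintegralD//.
apply: (stein_pointwise small (f := fun w => - stein_sol y w)
  (f' := fun w => - stein_sol' y w) (cs := [:: y])
  (G := fun w => - (w * stein_sol y w) + stein_variation w - (q - (y - e < w)%R%:R))
  (B := B) (h := fun w => - (q - (y - e < w)%R%:R) + stein_error w)) => //.
- by move=> w; apply: cvgN; exact: cf.
- move=> z; rewrite inE => zy; exact: is_derive_neg (is_derive_stein_sol zy).
- exact: measurableT_comp.
- apply: measurable_funB => //; apply: measurable_funD => //.
  exact: measurableT_comp.
- by move=> z; rewrite normrN; have [] := hB z 0.
- by move=> z; rewrite normrN; have [] := hB z 0.
- by move=> z; have [] := hB z (y - e).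
- by have := integrableN integrable_product; apply: eq_integrable => // w _;
    rewrite /= mulrN EFinN.
- move=> w t te; have := stein_product_variation x0 e0 e64 xe yx w te.
  rewrite ler_norml => /andP[v1 _]; have /andP[_ t2] := te.
  rewrite /stein_sol' -(addrA (_ * _)) opprD; apply: lerD; last first.
    by rewrite lerN2 lerD2l lerN2 indicator_shift_left.
  by move: v1; rewrite -/(stein_variation w) lerBrDl lerNl opprD opprK addrC.
- by have := integrableD measurableT iN iErr; exact: eq_integrable.
- move=> w D r hD hr _; have [_] := stein_tests_pointwise hD hr.
  by rewrite !mulrN opprK.
Qed.

End tail_comparison.

(** * Shifts of the normal tail *)

Section normal_tail_shift.
Context {R : realType}.
Implicit Types x e c : R.
Local Notation Phi := (@std_normal_cdf R).
Local Notation pdf := (normal_pdf (0 : R) 1).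

Lemma linear_le_cubic x : 0 <= x -> 1 + x <= 2 * (1 + x ^+ 3).
Proof.
move=> x0; have [x1|x1] := leP x 1.
  by have : 0 <= x ^+ 3 by [exact: exprn_ge0]; lra.
have : x <= x ^+ 3 by rewrite exprS ler_peMr// exprn_ege1// ltW.
lra.
Qed.

(** The hazard rate of the normal law grows linearly; a cubic bound suffices,
    since the relative error has this order anyway. *)
Lemma std_normal_pdf_le_tail x : 0 <= x -> pdf x <= 4 * (1 + x ^+ 3) * (1 - Phi x).
Proof.
move=> x0; have m0 := mills_gt0 x.
have -> : pdf x = (mills_ratio x)^-1 * (1 - Phi x).
  by rewrite std_normal_tailE mulKf// lt0r_neq0.
apply: ler_wpM2r; first exact: ltW (std_normal_tail_gt0 x).
by apply: (le_trans (mills_inv_le x0)); have := linear_le_cubic x0; lra.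
Qed.

Lemma std_normal_pdf_shift x e c : 0 <= x -> x * e <= 8^-1 -> 0 <= x - c <= e ->
  pdf c <= 2 * pdf x.
Proof.
move=> x0 xe /andP[c1 c2]; rewrite !std_normal_pdfE [leRHS]mulrCA.
rewrite ler_pM2l ?normal_peak1_gt0//.
apply: (@le_trans _ _ (expR (x * e) * expR (- 2^-1 * x ^+ 2))).
  rewrite -expRD ler_expR.
  have h1 : (x - c) * x <= e * x by apply: ler_wpM2r.
  have h2 : (x - c) * (x + c) = 2 * ((x - c) * x) - (x - c) ^+ 2 by ring.
  have := sqr_ge0 (x - c); lra.
apply: ler_wpM2r => //.
apply: (@le_trans _ _ (expR 8^-1)); first by rewrite ler_expR.
have /expR_le_1D2x : 0 <= (8^-1 : R) <= 2^-1 by apply/andP; split; lra.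
lra.
Qed.

Lemma normal_tail_shift_left x e : 0 <= x -> 0 < e -> x * e <= 8^-1 ->
  1 - Phi (x - e) <= (1 - Phi x) * (1 + 8 * (e * (1 + x ^+ 3))).
Proof.
move=> x0 e0 xe.
have [|c /andP[c1 c2] h] := @mean_value _ Phi pdf (x - e) x _ (fun z _ => is_derive_std_normal_cdf z).
  by lra.
have pc : pdf c <= 2 * pdf x by apply: std_normal_pdf_shift x0 xe _; apply/andP; split; lra.
have px := std_normal_pdf_le_tail x0.
have : pdf c * (x - (x - e)) <= 8 * (1 + x ^+ 3) * (1 - Phi x) * (x - (x - e)).
  by apply: ler_wpM2r; lra.
lra.
Qed.

Lemma normal_tail_shift_right x e : 0 <= x -> 0 < e ->
  (1 - Phi x) * (1 - 8 * (e * (1 + x ^+ 3))) <= 1 - Phi (x + e).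
Proof.
move=> x0 e0.
have [|c /andP[c1 c2] h] := @mean_value _ Phi pdf x (x + e) _ (fun z _ => is_derive_std_normal_cdf z).
  by lra.
have q0 := std_normal_tail_gt0 x.
have pc : pdf c <= pdf x.
  rewrite !std_normal_pdfE ler_pM2l ?normal_peak1_gt0// ler_expR.
  by have : x ^+ 2 <= c ^+ 2 by [rewrite lerXn2r ?nnegrE//; lra]; lra.
have px := std_normal_pdf_le_tail x0.
have x30 : 0 <= x ^+ 3 by exact: exprn_ge0.
have : pdf c * (x + e - x) <= 8 * (1 + x ^+ 3) * (1 - Phi x) * (x + e - x).
  apply: ler_wpM2r; first lra.
  have : 0 <= (1 + x ^+ 3) * (1 - Phi x) by apply: mulr_ge0; lra.
  lra.
lra.
Qed.

End normal_tail_shift.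

(** * The relative error *)

Section relative_error.
Context {R : realType}.
Local Notation Phi := (@std_normal_cdf R).

Lemma sandwich_relative_error (p q a b E K : R) :
  0 < q -> 0 < a -> 0 < b -> 0 <= E -> E <= 5 ->
  p <= a + a * (K * E) -> b - b * (K * E) <= p ->
  a <= q * (1 + 8 * E) -> q * (1 - 8 * E) <= b -> b <= q ->
  `|p / q - 1| <= (8 + 41 * `|K|) * E.
Proof.
move=> q0 a0 b0 E0 E5 up lo aq bq bq1.
have KE : K * E <= `|K| * E by apply: ler_wpM2r => //; exact: ler_norm.
have KE0 : 0 <= `|K| * E by exact: mulr_ge0.
rewrite -[X in _ - X](divff (lt0r_neq0 q0)) -mulrBl normrM normfV (gtr0_norm q0).
rewrite ler_pdivrMr// ler_norml; apply/andP; split.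
  have h : b * (K * E) <= q * (`|K| * E).
    apply: (@le_trans _ _ (b * (`|K| * E))); first by rewrite ler_pM2l.
    by apply: ler_wpM2r.
  have : 0 <= q * (`|K| * E) by apply: mulr_ge0 => //; exact: ltW.
  lra.
have h1 : a * (K * E) <= a * (`|K| * E) by rewrite ler_pM2l.
have h2 : a * (`|K| * E) <= (q * (1 + 8 * E)) * (`|K| * E) by apply: ler_wpM2r.
have h3 : (q * (1 + 8 * E)) * (`|K| * E) <= (q * 41) * (`|K| * E).
  apply: ler_wpM2r => //; rewrite ler_pM2l//; lra.
lra.
Qed.

(** The upper bound is taken at [y = x - e], the lower one at
    [y = x + e], and the normal tails at these two points are compared
    with the one at [x]. *)
Lemma relative_error_small d (T : measurableType d) (P : probability T R)
    (W Rem : {RV P >-> R}) (mu : R.-sfker T ~> R) (delta : R) (EDW ERW : T -> R)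
    (e al x : R) :
  small_remainders W Rem mu delta EDW ERW e al -> 0 <= x -> x ^+ 3 * e <= 4 ->
  `|tail_prob W x / (1 - Phi x) - 1| <=
    (8 + 41 * `|stein_const * moment_const al|) * (e * (1 + x ^+ 3)).
Proof.
move=> small x0 x3e.
have e0 := sr_e_gt0 small; have e64 := sr_e64 small.
have [xe _ _ _ _] := tilt_rateP x0 e0 e64 (sr_e small) x3e.
have yl : x - e <= x - e <= x + e by apply/andP; split; lra.
have yr : x - e <= x + e <= x + e by apply/andP; split; lra.
have up := tail_upper_bound small x0 x3e yl.
have lo := tail_lower_bound small x0 x3e yr.
rewrite subrK in up; rewrite addrK in lo.
have ql := normal_tail_shift_left x0 e0 xe.
have qr := normal_tail_shift_right x0 e0.
have qd : 1 - Phi (x + e) <= 1 - Phi x.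
  by apply: std_normal_tail_decr; rewrite lerDl ltW.
have q0 := std_normal_tail_gt0 x.
have E0 : 0 <= e * (1 + x ^+ 3).
  by apply: mulr_ge0; [exact: ltW|rewrite addr_ge0// exprn_ge0].
have E5 : e * (1 + x ^+ 3) <= 5.
  by rewrite mulrDr mulr1 (mulrC e); move: (x ^+ 3 * e) x3e => y; lra.
pose K := stein_const * moment_const al.
rewrite (_ : e * stein_const * _ = K * (e * (1 + x ^+ 3))) in up lo; last by rewrite /K; ring.
apply: (sandwich_relative_error q0 _ _ E0 E5 up lo ql qr qd); exact: std_normal_tail_gt0.
Qed.

Definition remainder_threshold (al : R) : R := Num.min ((1 - al) / 8) (20 ^+ 3)^-1.

Lemma remainder_threshold_gt0 al : al < 1 -> 0 < remainder_threshold al.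
Proof.
move=> al1; rewrite lt_min invr_gt0 exprn_gt0// andbT; lra.
Qed.

Definition bounded_range_const (eps : R) : R :=
  ((1 - Phi (1 + 4 / eps))^-1 + 1) / eps.

(** From [x ^+ 3 * e <= 4] and [eps < e] follows
    [x <= 1 + 4 / eps], and the ratio is at most the reciprocal of the
    normal tail at that point. *)
Lemma relative_error_bounded_range (p x e eps : R) :
  0 < eps < e -> 0 <= p <= 1 -> 0 <= x -> x ^+ 3 * e <= 4 ->
  `|p / (1 - Phi x) - 1| <= bounded_range_const eps * (e * (1 + x ^+ 3)).
Proof.
move=> /andP[eps0 epse] /andP[p0 p1] x0 x3e.
have x30 : 0 <= x ^+ 3 by exact: exprn_ge0.
have xX : x <= 1 + 4 / eps.
  have : x ^+ 3 <= 4 / eps.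
    rewrite ler_pdivlMr//; apply: le_trans x3e.
    by rewrite ler_wpM2l// ltW.
  have [x1|x1] := leP x 1; first lra.
  have : x <= x ^+ 3 by rewrite exprS ler_peMr// exprn_ege1// ltW.
  lra.
have QX := std_normal_tail_decr xX.
have QX0 := std_normal_tail_gt0 (1 + 4 / eps).
have q0 := std_normal_tail_gt0 x.
rewrite /bounded_range_const.
move: (1 - Phi x) (1 - Phi (1 + 4 / eps)) q0 QX0 QX => q Q q0 Q0 qQ.
have h0 : 0 <= p / q <= Q^-1.
  rewrite divr_ge0 ?(ltW q0)//= -[leRHS]mul1r; apply: ler_pM => //.
    by rewrite invr_ge0 ltW.
  by rewrite lef_pV2.
have iQ : 0 < Q^-1 by rewrite invr_gt0.
apply: (@le_trans _ _ (Q^-1 + 1)).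
  by move: h0 => /andP[h1 h2]; rewrite ler_norml; apply/andP; split; lra.
rewrite mulrAC -mulrA ler_peMr//; first lra.
by rewrite ler_pdivlMr// mul1r (le_trans (ltW epse))// ler_peMr//; lra.
Qed.

End relative_error.

Lemma range_cube {R : realType} (x theta a : R) (M : \bar R) :
  0 <= x -> 1 <= theta -> 0 <= a -> (0 <= M)%E ->
  (x%:E <= theta^-1%:E * M)%E -> (M <= inv_cube_root a)%E -> x ^+ 3 * a <= 1.
Proof.
move=> x0 th1 a0 M0 xM; rewrite /inv_cube_root.
have [->|an0] := eqVneq a 0; first by rewrite mulr0.
move=> Ma; have {an0}a1 : 0 < a by rewrite lt_neqAle eq_sym an0.
have : (x%:E <= (a `^ (- 3^-1))%:E)%E.
  apply: le_trans Ma; apply: (le_trans xM).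
  rewrite -[leRHS]mul1e; apply: lee_wpmul2r => //.
  by rewrite lee_fin invf_le1// (lt_le_trans ltr01).
rewrite lee_fin => h.
have h3 : x ^+ 3 <= (a `^ (- 3^-1)) ^+ 3 by rewrite lerXn2r ?nnegrE ?powR_ge0.
have e3 : (a `^ (- 3^-1)) ^+ 3 = a^-1.
  rewrite -powR_mulrn ?powR_ge0// -powRrM (_ : - 3^-1 * 3 = -1); last by field.
  by rewrite powR_inv1.
by rewrite -ler_pdivlMr// div1r -e3.
Qed.

Lemma inv_cube_root_ge0 {R : realType} (a : R) : (0 <= inv_cube_root a)%E.
Proof. by rewrite /inv_cube_root; case: ifP; rewrite ?leey// lee_fin powR_ge0. Qed.

(** * The moderate deviation bound *)

Section uniform_bound.
Context {R : realType}.

Definition error_const (al : R) : R :=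
  8 + 41 * `|stein_const * moment_const al| +
  `|bounded_range_const (remainder_threshold al)|.

Lemma error_const_ge0 al : 0 <= error_const al.
Proof.
by apply: addr_ge0 => //; apply: addr_ge0 => //; exact: mulr_ge0.
Qed.

Section bound.
Context {d} {T : measurableType d}.
Variables (P : probability T R) (W Rem : {RV P >-> R}) (mu : R.-sfker T ~> R).
Variables (delta delta1 delta2 : R) (EDW ERW : T -> R) (al : R).
Hypotheses (al01 : 0 <= al < 1) (d0 : 0 < delta) (d10 : 0 <= delta1) (d20 : 0 <= delta2).
Hypothesis steinW : stein_identity W Rem mu delta.
Hypothesis hEDW : is_cond_expectation P W (random_mass mu delta) EDW.
Hypothesis hERW : is_cond_expectation P W (EFin \o Rem) ERW.
Hypothesis aD : {ae P, forall w, `|EDW w - 1| <= delta1 * (1 + `|W w|)}.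
Hypothesis aR2 : {ae P, forall w, `|ERW w| <= 2 * delta2 * (1 + W w ^+ 2)}.
Hypothesis aR1 : delta2 <= 2^-1 ->
  {ae P, forall w, `|ERW w| <= 2 * delta2 + al * `|W w|}.

(** The factor [2] comes from [1 + `|w| <= 2 * (1 + w ^+ 2)], under the first
    alternative. *)
Let e : R := delta + delta1 + 2 * delta2.

Let e0 : 0 < e.
Proof. by rewrite /e -addrA ltr_wpDr// addr_ge0// mulr_ge0. Qed.

Let small_of_threshold : e <= remainder_threshold al ->
  small_remainders W Rem mu delta EDW ERW e al.
Proof.
rewrite le_min => /andP[h1 h2].
have e8 : 8 * e <= 1 - al by rewrite mulrC -ler_pdivlMr.
have e20 : 20 ^+ 3 * e <= 1 by rewrite mulrC -ler_pdivlMr ?exprn_gt0// div1r.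
have de : delta <= e by rewrite /e -addrA lerDl addr_ge0// mulr_ge0.
have d1e : delta1 <= e.
  by rewrite /e addrAC lerDr addr_ge0 ?(ltW d0)// mulr_ge0.
have d2e : 2 * delta2 <= e by rewrite /e lerDr addr_ge0// ltW.
have d2h : delta2 <= 2^-1.
  by have /andP[a0 _] := al01; move: e a0 d2e e8 => E *; lra.
split=> //; first by rewrite d0.
- by apply: filterS aD => w h; apply: (le_trans h); apply: ler_wpM2r.
- apply: filterS aR2 => w h; apply: (le_trans h); apply: ler_wpM2r => //.
  by rewrite addr_ge0// sqr_ge0.
- by apply: filterS (aR1 d2h) => w h; apply: (le_trans h); rewrite lerD2r.
Qed.

Lemma relative_error (x : R) : 0 <= x -> x ^+ 3 * e <= 4 ->
  `|tail_prob W x / (1 - std_normal_cdf x) - 1| <= error_const al * (e * (1 + x ^+ 3)).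
Proof.
move=> x0 x3e.
have E0 : 0 <= e * (1 + x ^+ 3).
  by apply: mulr_ge0; [exact: ltW|rewrite addr_ge0// exprn_ge0].
have [al0 al1] := andP al01.
have [epse|epse] := ltP (remainder_threshold al) e.
  have range : 0 < remainder_threshold al < e by rewrite remainder_threshold_gt0.
  apply: (le_trans (relative_error_bounded_range range (tail_prob01 W x) x0 x3e)).
  apply: ler_wpM2r => //; apply: (le_trans (ler_norm _)).
  by rewrite lerDr addr_ge0// mulr_ge0.
apply: (le_trans (relative_error_small (small_of_threshold epse) x0 x3e)).
by apply: ler_wpM2r => //; rewrite lerDl.
Qed.

Lemma moderate_deviation (theta : R) : 1 <= theta ->
  moderate_deviation_bound W delta delta1 delta2 theta (2 * error_const al).
Proof.
move=> th1 x x0 xle.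
pose M : \bar R := mine (inv_cube_root delta)
  (mine (inv_cube_root delta1) (inv_cube_root delta2)).
have M0 : (0 <= M)%E by rewrite /M !le_min !inv_cube_root_ge0.
have cube (a : R) : 0 <= a -> (M <= inv_cube_root a)%E -> x ^+ 3 * a <= 1.
  by move=> a0; exact: range_cube x0 th1 a0 M0 xle.
have xd : x ^+ 3 * delta <= 1 by apply: cube; [exact: ltW|rewrite /M ge_min lexx].
have xd1 : x ^+ 3 * delta1 <= 1 by apply: cube => //; rewrite /M !ge_min lexx orbT.
have xd2 : x ^+ 3 * delta2 <= 1 by apply: cube => //; rewrite /M !ge_min lexx !orbT.
have x3e : x ^+ 3 * e <= 4 by rewrite /e; lra.
have key := relative_error x0 x3e; rewrite /tail_prob in key.
have x30 : 0 < 1 + x ^+ 3 by rewrite ltr_pwDl// exprn_ge0.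
set S := delta + delta1 + delta2.
have S0 : 0 < S by rewrite /S -addrA ltr_wpDr// addr_ge0.
have eS : e <= 2 * S by rewrite /e /S; have := d0; have := d10; lra.
have t3 : 1 <= theta ^+ 3 by exact: exprn_ege1.
set ratio := _ / _ in key *.
have D0 : 0 < theta ^+ 3 * (1 + x ^+ 3) * S.
  by rewrite !mulr_gt0// (lt_le_trans ltr01).
exists ((ratio - 1) / (theta ^+ 3 * (1 + x ^+ 3) * S)); last first.
  rewrite -2!(mulrA ((ratio - 1) / _)).
  by rewrite divfK ?lt0r_neq0// addrC subrK.
rewrite normrM normfV (gtr0_norm D0) ler_pdivrMr//; apply: (le_trans key).
rewrite [2 * _]mulrC -[leRHS]mulrA; apply: ler_wpM2l; first exact: error_const_ge0.
apply: (@le_trans _ _ (2 * S * (1 + x ^+ 3))); first by rewrite ler_pM2r.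
rewrite -[leLHS]mulrA; apply: ler_wpM2l => //.
rewrite -mulrA [S * _]mulrC ler_peMl//.
by apply: ltW; exact: mulr_gt0.
Qed.

End bound.
End uniform_bound.

Theorem theorem3p1 (R : realType) :
  exists (C1 : R) (C2 : R -> R),
  forall (d : measure_display) (T : measurableType d) (P : probability T R)
    (W Rem : {RV P >-> R}) (mu : R.-sfker T ~> R)
    (delta delta1 delta2 theta : R) (EDW ERW : T -> R),
  0 < delta ->
  {ae P, forall w, mu w (~` `[- delta, delta]%classic) = 0%E} ->
  stein_identity W Rem mu delta ->
  is_cond_expectation P W (random_mass mu delta) EDW ->
  is_cond_expectation P W (EFin \o Rem) ERW ->
  0 <= delta1 -> 0 <= delta2 -> 1 <= theta ->
  {ae P, forall w, `|EDW w - 1| <= delta1 * (1 + `|W w|)} ->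
  {ae P, forall w, EDW w <= theta} ->
  ({ae P, forall w, `|ERW w| <= delta2 * (1 + `|W w|)} ->
     moderate_deviation_bound W delta delta1 delta2 theta C1) /\
  (forall alpha : R, alpha < 1 ->
     {ae P, forall w, `|ERW w| <= delta2 * (1 + W w ^+ 2)} ->
     {ae P, forall w, delta2 * `|W w| <= alpha} ->
     moderate_deviation_bound W delta delta1 delta2 theta (C2 alpha)).
Proof.
(* Under the first alternative, delta2 |w| is at most |w| / 2 once delta2 is at
   most 1/2. *)
exists (2 * error_const 2^-1), (fun alpha => 2 * error_const (Num.max alpha 0)).
move=> d T P W Rem mu delta delta1 delta2 theta EDW ERW d0 _ st hD hR d10 d20 th1
  aD _; split.
  move=> aR; apply: (moderate_deviation _ d0 d10 d20 st hD hR aD _ _ th1).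
  - by apply/andP; split; lra.
  - apply: filterS aR => w h; apply: (le_trans h).
    rewrite [2 * _]mulrC -mulrA; apply: ler_wpM2l => //.
    by have := abs_le_1Dsqr (W w); have := sqr_ge0 (W w); lra.
  - move=> dh; apply: filterS aR => w h; apply: (le_trans h).
    have : delta2 * `|W w| <= 2^-1 * `|W w| by exact: ler_wpM2r.
    lra.
move=> alpha al1 aR aW; apply: (moderate_deviation _ d0 d10 d20 st hD hR aD _ _ th1).
- by rewrite le_max lexx orbT/= gt_max al1 ltr01.
- apply: filterS aR => w h; apply: (le_trans h); apply: ler_wpM2r.
    by rewrite addr_ge0// sqr_ge0.
  lra.
- move=> _; apply: filterS2 aR aW => w h hw; apply: (le_trans h).
  (* The quadratic part is linear in disguise: delta2 w^2 = (delta2 |w|) |w|. *)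
  have -> : delta2 * (1 + W w ^+ 2) = delta2 + delta2 * `|W w| * `|W w|.
    by rewrite -mulrA -expr2 -normrX ger0_norm ?sqr_ge0// mulrDr mulr1.
  apply: lerD; first lra.
  by apply: ler_wpM2r => //; apply: (le_trans hw); rewrite le_max lexx.
Qed.
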